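(* Let $f\in L^\infty(\mathbb{R})$ and let $\hat f$ be its Fourier transform, defined by $\hat f=\hat f_1-\Psi_f''$ as in the context. Then there are a continuous function $\Phi_f$ on $\mathbb{R}$ such that $\hat f=\Phi_f''$ (second distributional derivative) and a constant $k$ such that $$|\Phi_f(s+h)-\Phi_f(s)|\le k\|f\|_\infty\,|h|\,\bigl(\bigl|\log|h|\bigr|+\log(|s|+1)\bigr)$$ for each $s\in\mathbb{R}$ and each $0<|h|\le1/e$. The function $\Phi_f$ need not be Lipschitz continuous (i.e., there is $f\in L^\infty(\mathbb{R})$ for which $\Phi_f$ is not Lipschitz continuous).
   Context: Functions are complex-valued. $\mathcal{S}(\mathbb{R})$ is the Schwartz space. For $f\in L^\infty(\mathbb{R})$ write $f=f_1+f_2$ with $f_1=f\chi_{[-1,1]}$ and $f_2=f\chi_{\mathbb{R}\setminus[-1,1]}$. Define $\hat f_1(s)=\int_{-1}^1e^{-ist}f(t)\,dt$ and $\Psi_f(s)=\int_{|t|>1}e^{-ist}f(t)\,\frac{dt}{t^2}$. Define $\hat f_2=-\Psi_f''$ in the distributional sense, i.e. $\langle\hat f_2,\phi\rangle=-\int_{-\infty}^\infty\Psi_f(s)\phi''(s)\,ds$ for each $\phi\in\mathcal{S}(\mathbb{R})$. The Fourier transform of $f$ is the tempered distribution $\hat f=\hat f_1+\hat f_2$. *)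

(* Defs.v *)
From mathcomp Require Import all_boot all_order all_algebra.
From mathcomp Require Import all_classical all_reals all_analysis.
From mathcomp Require Import complex.

Set Implicit Arguments.
Unset Strict Implicit.
Unset Printing Implicit Defensive.

Import Order.TTheory GRing.Theory Num.Theory.
Import numFieldNormedType.Exports.
Local Open Scope classical_set_scope.
Local Open Scope ring_scope.
Local Open Scope complex_scope.

(* [complex] has no measurable, Lebesgue-integral or real normed-module
   structure in the libraries, so measurability, integrals and derivatives of
   functions from R to R[i] are taken on real and imaginary parts.
   Measurability is for Borel sets: every class in L^oo has a Borel
   representative, on which the transform and the norm do not depend. *)

Definition cmeasurable (R : realType) (f : R -> R[i]) : Prop :=
  measurable_fun setT (fun t => complex.Re (f t))
  /\ measurable_fun setT (fun t => complex.Im (f t)).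

Definition cintegrable (R : realType) (D : set R) (f : R -> R[i]) : Prop :=
  lebesgue_measure.-integrable D (EFin \o (fun t => complex.Re (f t)))
  /\ lebesgue_measure.-integrable D (EFin \o (fun t => complex.Im (f t))).

Definition cintegral (R : realType) (D : set R) (f : R -> R[i]) : R[i] :=
  Rintegral lebesgue_measure D (fun t => complex.Re (f t))
  +i* Rintegral lebesgue_measure D (fun t => complex.Im (f t)).

Definition cderiven (R : realType) (n : nat) (f : R -> R[i]) (x : R) : R[i] :=
  derive1n n (fun t => complex.Re (f t)) x
  +i* derive1n n (fun t => complex.Im (f t)) x.

Definition csmooth (R : realType) (f : R -> R[i]) : Prop :=
  forall (n : nat) (x : R),
    derivable (derive1n n (fun t => complex.Re (f t))) x 1
    /\ derivable (derive1n n (fun t => complex.Im (f t))) x 1.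

Definition schwartz (R : realType) (phi : R -> R[i]) : Prop :=
  csmooth phi
  /\ forall m n : nat, exists M : R, forall x : R,
       `|x| ^+ m * Normc.normc (cderiven n phi x) <= M.

Definition expi (R : realType) (x : R) : R[i] := cos x +i* sin x.

(* The essential supremum of |f|. [Normc.normc] is the modulus as an element of R; the norm of R[i] itself
   takes its values in R[i]. *)
Definition Linfty_enorm (R : realType) (f : R -> R[i]) : \bar R :=
  Lnorm lebesgue_measure +oo%E (fun t => (Normc.normc (f t))%:E).

Definition Linfty (R : realType) (f : R -> R[i]) : Prop :=
  cmeasurable f /\ (Linfty_enorm f < +oo)%E.

Definition Linfty_norm (R : realType) (f : R -> R[i]) : R :=
  fine (Linfty_enorm f).

Definition fhat1 (R : realType) (f : R -> R[i]) (s : R) : R[i] :=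
  cintegral `[-1, 1] (fun t => expi (- (s * t)) * f t).

Definition Psi (R : realType) (f : R -> R[i]) (s : R) : R[i] :=
  cintegral [set t | 1 < `|t|] (fun t => expi (- (s * t)) * f t / (t ^+ 2)%:C).

(* Tempered distributions are functionals whose values matter only on Schwartz
   functions; the function [fhat1 f] acts by integration. *)
Definition fourier (R : realType) (f phi : R -> R[i]) : R[i] :=
  cintegral setT (fun s => fhat1 f s * phi s)
  - cintegral setT (fun s => Psi f s * cderiven 2 phi s).

(* T = F'' as tempered distributions. The integrability clause says that F acts
   by integration on second derivatives of Schwartz functions: [Rintegral] is
   total and takes a default value on non-integrable functions. *)
Definition is_second_distr_derivative (R : realType)
    (F : R -> R[i]) (T : (R -> R[i]) -> R[i]) : Prop :=
  forall phi : R -> R[i], schwartz phi ->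
    cintegrable setT (fun s => F s * cderiven 2 phi s)
    /\ T phi = cintegral setT (fun s => F s * cderiven 2 phi s).

Definition clipschitz (R : realType) (F : R -> R[i]) : Prop :=
  exists L : R, forall x y : R,
    Normc.normc (F x - F y) <= L * `|x - y|.

(* Main.v *)
(** Write [Phi = G - Psi f], where [G] integrates [f] over [-1, 1] against
    [(1 - i s t - e^(-ist)) / t^2], whose second derivative in [s] is
    [e^(-ist)]; two integrations by parts against a Schwartz function give
    [Phi'' = fhat].  The modulus of continuity comes from
    [|e^(-iht) - 1| <= min(|h t|, 2)] on [|t| > 1], which yields
    [|h| |log |h||], and from [|G' s| <= C ||f|| log (|s| + 2)].

    For [f] the indicator of ]1, +oo[, [Im Psi f] behaves like
    [s log (1 / |s|)] up to sign near 0.  If [Phi] were Lipschitz, testing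
    against the steps [sigma (l x) - sigma x], [sigma] the logistic function,
    would bound [int Phi phi''] uniformly in [l], since [phi''] is odd and
    [int |x phi'' x| dx] is bounded, whereas [int (Psi f) phi''] grows like
    [log l]. *)

Require Import Defs.
From mathcomp Require Import all_boot all_order all_algebra.
From mathcomp Require Import all_classical all_reals all_analysis.
From mathcomp Require Import measurable_realfun ess_sup_inf complex.
From mathcomp Require Import ring lra.
Set Implicit Arguments.
Unset Strict Implicit.
Unset Printing Implicit Defensive.
Import Order.TTheory GRing.Theory Num.Theory.
Import numFieldNormedType.Exports.
Local Open Scope classical_set_scope.
Local Open Scope ring_scope.
Local Open Scope complex_scope.

(** * Majorants *)

Section Majorants.
Context {R : realType}.
Notation mu := (@lebesgue_measure R).

(** The estimates do not split integrals at [|t| = 1 / |h|]: a minimum such as [min(|h t|, 2)] is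
    replaced by a rational function with an explicit antiderivative, and the logarithm is the exact
    integral of that function. The polynomial [1 - i s t] in the kernel of [G] cancels the
    singularity at [t = 0] and is invisible to a second derivative in [s]. Since the kernels need
    pointwise bounds, [f] is first modified on a null set. For the negative half, [Phi] is known
    only through its pairing with Schwartz functions, and a logistic function is not one; the fixed
    term [sigma x] is subtracted to obtain decay and contributes only a constant. The growth comes
    from [x] of size [1 / l]: there [phi''] has size [l^2], [Im Psi f] has size [(log l) / l], and
    the window has length of order [1 / l]. Elsewhere the integrand may have the wrong sign, but the
    negative part has an integral bounded in [l]. *)

Lemma integral_itvcy_antiderivative (f F : R -> R) (b l : R) :
  (forall x, b <= x -> 0 <= f x) ->
  (forall x, b <= x -> is_derive x 1 F (f x)) ->
  (forall x, b <= x -> {for x, continuous f}) ->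
  F x @[x --> +oo] --> l ->
  (\int[mu]_(x in `[b, +oo[) (f x)%:E = (l - F b)%:E)%E.
Proof.
move=> f0 dF cf Fl; rewrite EFinB.
apply: ge0_continuous_FTC2y => //.
- apply: continuous_in_subspaceT => x; rewrite inE/= in_itv/= andbT => bx.
  exact: cf.
- by move=> x /ltW bx; have [] := dF _ bx.
- apply: cvg_at_right_filter; apply: differentiable_continuous.
  by apply/derivable1_diffP; have [] := dF _ (lexx b).
- move=> x; rewrite in_itv/= andbT => /ltW bx.
  by rewrite derive1E; have [_ ->] := dF _ bx.
Qed.

(* Up to a constant, [log_majorant a t] dominates both [min(a |t|, 1) / t^2] for
   [|t| > 1] and [min(a, 1 / |t|)] for [|t| <= 1]. *)
Definition log_majorant (a t : R) : R := a / ((1 + `|t|) * (1 + a * `|t|)).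
(** A rescaling of one profile: the integral is 2 for every [a > 0], so bounds by it are uniform in
    [a]. The case [a = 1] is the standard integrable weight. *)
Definition sqr_majorant (a t : R) : R := a / (1 + a * `|t|) ^+ 2.

Lemma cvg_affine_ratio (a : R) : 
  (1 + a * t) / (1 + t) @[t --> +oo] --> a.
Proof.
have h : (1 - a) / (1 + t) @[t --> +oo] --> (0 : R).
  rewrite -(mulr0 (1 - a)); apply: cvgMl_tmp.
  apply/gtr0_cvgV0; last first.
    by apply: cvg_addrl; exact: cvg_id.
  near=> t; rewrite ltr_wpDr//; near: t; exact: nbhs_pinfty_ge.
have -> : a = a + 0 by rewrite addr0.
apply: (cvg_trans _ (cvgD (cvg_cst a) h)).
apply: near_eq_cvg; near=> t => /=.
have t0 : 0 < t by near: t; exact: nbhs_pinfty_gt.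
rewrite fctE; field.
by apply/eqP => t1; lra.
Unshelve. all: by end_near. Qed.

Lemma integral_log_majorant_itvcy (a b : R) : 0 < a -> a != 1 -> 0 <= b ->
  (\int[mu]_(t in `[b, +oo[) (log_majorant a t)%:E =
    (a / (a - 1) * (ln a - ln ((1 + a * b) / (1 + b))))%:E)%E.
Proof.
move=> a0 a1 b0.
have pos t : b <= t -> 0 < 1 + t by lra.
have pos' t : b <= t -> 0 < 1 + a * t by nra.
have a1' : a - 1 != 0 by rewrite subr_eq0.
(* Partial fractions: [(a - 1) / ((1 + t) (1 + a t)) = a / (1 + a t) - 1 / (1 + t)]. *)
pose F t := a / (a - 1) * ln ((1 + a * t) / (1 + t)).
have <- : a / (a - 1) * ln a - F b = a / (a - 1) * (ln a - ln ((1 + a * b) / (1 + b))).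
  by rewrite mulrBr.
transitivity (\int[mu]_(t in `[b, +oo[) (a / ((1 + t) * (1 + a * t)))%:E)%E.
  apply: eq_integral => t; rewrite inE/= in_itv/= andbT => bt.
  by rewrite /log_majorant ger0_norm ?(le_trans b0).
apply: integral_itvcy_antiderivative.
- move=> t bt; rewrite divr_ge0 ?mulr_ge0// ltW//; [exact: pos|exact: pos'].
- move=> t bt.
  have p1 := pos _ bt; have p2 := pos' _ bt.
  have n1 : 1 + t != 0 by rewrite gt_eqF.
  have n2 : 1 + a * t != 0 by rewrite gt_eqF.
  have d1 : is_derive t 1 (fun t : R => (1 + a * t) / (1 + t))
      (((1 + t) * a - (1 + a * t)) / (1 + t) ^+ 2).
    apply: is_derive_eq.
    rewrite /GRing.scale/=; field; exact: n1.
  have d2 : is_derive ((1 + a * t) / (1 + t)) 1 (@ln R) ((1 + a * t) / (1 + t))^-1.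
    by apply: is_derive1_ln; rewrite divr_gt0.
  have d3 := @is_derive1_comp _ _ (fun t : R => (1 + a * t) / (1 + t)) t _ _ d2 d1.
  have d4 := is_deriveZ (a / (a - 1)) d3.
  apply: (is_derive_eq d4).
  rewrite /GRing.scale/=; field.
  by rewrite n1 n2 a1'.
- move=> t bt.
  have n1 : 1 + t != 0 by rewrite gt_eqF ?pos.
  have n2 : 1 + a * t != 0 by rewrite gt_eqF ?pos'.
  apply: differentiable_continuous; apply/derivable1_diffP.
  apply: derivableM => //; apply: derivableV => //; first by rewrite mulf_neq0.
- have h : ln ((1 + a * t) / (1 + t)) @[t --> +oo] --> ln a.
    by apply: (cvg_comp (fun t => (1 + a * t) / (1 + t)) (@ln R)); [exact: cvg_affine_ratio|exact: continuous_ln].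
  exact: (cvgM (cvg_cst _) h).
Qed.

Lemma integral_sqr_majorant_itvcy (a : R) : 0 < a ->
  (\int[mu]_(t in `[0%R, +oo[) (sqr_majorant a t)%:E = 1%:E)%E.
Proof.
move=> a0.
have pos' t : 0 <= t -> 0 < 1 + a * t by nra.
pose F t := - (1 + a * t)^-1.
have -> : 1 = 0 - F 0 by rewrite /F mulr0 addr0 invr1; ring.
transitivity (\int[mu]_(t in `[0%R, +oo[) (a / (1 + a * t) ^+ 2)%:E)%E.
  apply: eq_integral => t; rewrite inE/= in_itv/= andbT => bt.
  by rewrite /sqr_majorant ger0_norm.
apply: integral_itvcy_antiderivative.
- by move=> t /pos' p; rewrite divr_ge0 ?exprn_ge0// ltW.
- move=> t /pos' p.
  have n2 : 1 + a * t != 0 by rewrite gt_eqF.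
  apply: is_derive_eq.
    rewrite /GRing.scale/=; field; exact: n2.
- move=> t /pos' p.
  have n2 : 1 + a * t != 0 by rewrite gt_eqF.
  apply: differentiable_continuous; apply/derivable1_diffP.
  apply: derivableM => //; apply: derivableV => //; exact: expf_neq0.
- rewrite -oppr0; apply: cvgN; apply/gtr0_cvgV0.
    near=> t; apply: pos'; near: t; exact: nbhs_pinfty_ge.
  apply: (cvg_comp ( *%R a) (fun y => 1 + y)); last exact: cvg_addrl.
  exact: (gt0_cvgMry a0 (cvg_id (F := pinfty_nbhs R))).
Unshelve. all: by end_near. Qed.

Lemma log_majorant_ge0 (a t : R) : 0 <= a -> 0 <= log_majorant a t.
Proof. by move=> a0; rewrite divr_ge0 ?mulr_ge0 ?addr_ge0 ?mulr_ge0. Qed.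

Lemma sqr_majorant_ge0 (a t : R) : 0 <= a -> 0 <= sqr_majorant a t.
Proof. by move=> a0; rewrite divr_ge0 ?exprn_ge0 ?addr_ge0 ?mulr_ge0. Qed.

Lemma continuous_majorant_denominator (a t : R) : 0 <= a ->
  {for t, continuous (fun x => 1 + a * `|x|)} /\ 1 + a * `|t| != 0.
Proof.
move=> a0; split; last by rewrite gt_eqF// ltr_wpDr// mulr_ge0.
by apply: cvgD; [exact: cvg_cst|apply: cvgMl_tmp; exact: norm_continuous].
Qed.

Lemma continuous_log_majorant (a : R) : 0 <= a -> continuous (log_majorant a).
Proof.
move=> a0 t.
have [c1 n1] := continuous_majorant_denominator t a0.
have [c2 n2] := continuous_majorant_denominator t (@ler01 R).
have E : (fun x : R => 1 + 1 * `|x|) = (fun x => 1 + `|x|).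
  by apply/funext => x; rewrite mul1r.
rewrite E mul1r in c2 n2.
apply: cvgM; first exact: cvg_cst.
by apply: cvgV; [rewrite mulf_neq0|exact: cvgM].
Qed.

Lemma continuous_sqr_majorant (a : R) : 0 <= a -> continuous (sqr_majorant a).
Proof.
move=> a0 t; have [c1 n1] := continuous_majorant_denominator t a0.
apply: cvgM; first exact: cvg_cst.
apply: cvgV; first by rewrite expf_neq0.
by rewrite expr2; under eq_fun do rewrite expr2; exact: cvgM.
Qed.

Lemma integral_log_majorant (a : R) : 0 < a -> a != 1 ->
  (\int[mu]_t (log_majorant a t)%:E = (2 * (a / (a - 1) * ln a))%:E)%E.
Proof.
move=> a0 a1; rewrite ge0_symfun_integralT//.
- rewrite -set_itvcy integral_log_majorant_itvcy// mulr0 !addr0 divr1 ln1.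
  by rewrite subr0 EFinM.
- by move=> x; apply: log_majorant_ge0; exact: ltW.
- by apply: continuous_log_majorant; exact: ltW.
- by move=> x; rewrite /= /log_majorant normrN.
Qed.

Lemma integral_sqr_majorant (a : R) : 0 < a ->
  (\int[mu]_t (sqr_majorant a t)%:E = 2%:E)%E.
Proof.
move=> a0; rewrite ge0_symfun_integralT//.
- by rewrite -set_itvcy integral_sqr_majorant_itvcy// mule1.
- by move=> x; apply: sqr_majorant_ge0; exact: ltW.
- by apply: continuous_sqr_majorant; exact: ltW.
- by move=> x; rewrite /= /sqr_majorant normrN.
Qed.

Lemma integrable_continuous_ge0 (m : R -> R) (c : R) :
  continuous m -> (forall t, 0 <= m t) ->
  (\int[mu]_t (m t)%:E = c%:E)%E ->
  mu.-integrable setT (EFin \o m) /\ \int[mu]_t m t = c.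
Proof.
move=> cm m0 mc; split; last by rewrite /Rintegral mc.
apply/integrableP; split.
  by apply/measurable_EFinP; exact: continuous_measurable_fun.
under eq_integral do rewrite /= ger0_norm//.
by rewrite mc ltry.
Qed.

Lemma integrable_log_majorant (a : R) : 0 < a -> a != 1 ->
  mu.-integrable setT (EFin \o log_majorant a) /\
  \int[mu]_t log_majorant a t = 2 * (a / (a - 1) * ln a).
Proof.
move=> a0 a1; apply: integrable_continuous_ge0; last exact: integral_log_majorant.
- by apply: continuous_log_majorant; exact: ltW.
- by move=> t; apply: log_majorant_ge0; exact: ltW.
Qed.

Lemma integrable_sqr_majorant (a : R) : 0 < a ->
  mu.-integrable setT (EFin \o sqr_majorant a) /\
  \int[mu]_t sqr_majorant a t = 2.
Proof.
move=> a0; apply: integrable_continuous_ge0; last exact: integral_sqr_majorant.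
- by apply: continuous_sqr_majorant; exact: ltW.
- by move=> t; apply: sqr_majorant_ge0; exact: ltW.
Qed.

(** The majorant is integrated over the whole line, where its integral is known in closed form, so
    that one formula serves both [[-1, 1]] and [|t| > 1]. *)
Lemma majorized_Rintegral (D : set R) (f m : R -> R) (c : R) :
  measurable D -> measurable_fun D f ->
  mu.-integrable setT (EFin \o m) -> (forall t, 0 <= m t) -> 0 <= c ->
  (forall t, D t -> `|f t| <= c * m t) ->
  mu.-integrable D (EFin \o f) /\ `|\int[mu]_(t in D) f t| <= c * \int[mu]_t m t.
Proof.
move=> mD mf im m0 c0 fm.
have icm : mu.-integrable setT (EFin \o (fun t => c * m t)).
  rewrite (_ : EFin \o _ = (fun t => c%:E * (EFin \o m) t)%E); first exact: integrableZl.
  by apply/funext => t; rewrite /= EFinM.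
have icmD : mu.-integrable D (EFin \o (fun t => c * m t)).
  by apply: (integrableS measurableT).
have fi : mu.-integrable D (EFin \o f).
  apply: le_integrable icmD => //; first exact/measurable_EFinP.
  by move=> t Dt; rewrite /= lee_fin (ger0_norm (mulr_ge0 c0 (m0 t))) fm.
split => //.
apply: le_trans; first exact: (@le_normr_Rintegral _ _ _ mu _ _ mD fi).
rewrite -RintegralZl//.
apply: (@le_trans _ _ (\int[mu]_(t in D) (c * m t))).
  apply: le_Rintegral => //; exact: integrable_norm.
rewrite Rintegral_mkcond.
apply: le_Rintegral => //.
  have := (@integrable_mkcond _ _ _ mu D (EFin \o (fun t => c * m t)) mD).1 icmD.
  by rewrite restrict_EFin.
move=> t _; rewrite patchE; case: ifP => // _; exact: mulr_ge0.
Qed.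
End Majorants.

(** * Elementary inequalities for sine and cosine, and domination by the majorants *)

Section ElementaryBounds.
Context {R : realType}.
Implicit Types x y s t h : R.

Lemma mean_value_le (f df : R -> R) (a b C : R) :
  (forall x, is_derive x 1 f (df x)) ->
  (forall x, Num.min a b <= x <= Num.max a b -> `|df x| <= C) ->
  `|f b - f a| <= C * `|b - a|.
Proof.
move=> fdf; wlog ab : a b / a <= b => [H dfC|].
  have [/H|/ltW /H] := leP a b; first exact.
  by rewrite minC maxC distrC (distrC a) => /(_ dfC).
rewrite (min_idPl ab) (max_idPr ab) => dfC.
have cf : {within `[a, b], continuous f}.
  apply: derivable_within_continuous => x _.
  by have [] := fdf x.
have [c cab ->] := @MVT_segment _ f df a b ab (fun x _ => fdf x) cf.
rewrite normrM ler_wpM2r// dfC//.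
Qed.

Lemma sin_lipschitz x y : `|sin x - sin y| <= `|x - y|.
Proof.
rewrite -[leRHS]mul1r; apply: (mean_value_le (df := cos)) => z _.
exact: cos_max.
Qed.

Lemma cos_lipschitz x y : `|cos x - cos y| <= `|x - y|.
Proof.
rewrite -[leRHS]mul1r; apply: (mean_value_le (df := fun x => - sin x)) => z _.
by rewrite normrN; exact: sin_max.
Qed.

Lemma norm_sin_le x : `|sin x| <= `|x|.
Proof. by have := sin_lipschitz x 0; rewrite sin0 !subr0. Qed.

Lemma norm_oneBcos_le x : `|1 - cos x| <= `|x|.
Proof. by have := cos_lipschitz 0 x; rewrite cos0 sub0r normrN. Qed.

Lemma norm_oneBcos_le2 x : `|1 - cos x| <= 2.
Proof. by have := cos_le1 x; have := cos_geN1 x; rewrite ler_norml; lra. Qed.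

Lemma norm_sin_le2 x : `|sin x| <= 2.
Proof. by rewrite (le_trans (sin_max _))// ler1n. Qed.

Lemma norm_oneBcos_le_sqr x : `|1 - cos x| <= x ^+ 2.
Proof.
have -> : x = (x / 2) *+ 2 by rewrite -mulr_natr; field.
rewrite cos_mulr2n -mulr_natr cos2sin2.
have := norm_sin_le (x / 2); move: (x / 2) => y yP.
have : sin y ^+ 2 <= y ^+ 2 by rewrite -(real_normK (num_real (sin y))) -(real_normK (num_real y)) ler_sqr ?nnegrE.
rewrite -mulr_natr ger0_norm; nra.
Qed.

(** The derivative [1 - cos z] is at most [|x|] between 0 and [x]. A quadratic bound is enough to
    cancel the [t ^+ 2] below the kernel. *)
Lemma norm_idBsin_le_sqr x : `|x - sin x| <= x ^+ 2.
Proof.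
have -> : x - sin x = (x - sin x) - (0 - sin 0) by rewrite sin0; ring.
rewrite -(real_normK (num_real x)) expr2 -[X in _ * `|X|]subr0.
apply: (mean_value_le (f := fun x => x - sin x) (df := fun x => 1 - cos x)) => z.
move=> /andP[z1 z2]; apply: (le_trans (norm_oneBcos_le z)).
move: z1 z2; rewrite ge_min le_max => /orP[z1|z1] /orP[z2|z2].
- by rewrite (_ : z = 0) ?normr0//; lra.
- by rewrite !ger0_norm//; lra.
- by rewrite !ler0_norm//; lra.
- by rewrite (_ : z = x)//; lra.
Qed.

(** Add [y <= x] and [y x <= 2 x]. This is the passage from [min(x, 2)] to a rational function. *)
Lemma le_min_ratio x y : 0 <= x -> y <= x -> y <= 2 -> y <= 3 * (x / (1 + x)).
Proof. by move=> x0 yx y2; rewrite mulrA ler_pdivlMr; nra. Qed.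

(** The 6 is the 3 of [le_min_ratio] times 2, since [1 <= 2 / (1 + |t|)] here. Allowing [A] above
    [|s|] makes it possible to keep [A] away from 1, where the formula for the integral
    degenerates. *)
Lemma log_majorant_inside (A s t y : R) : 0 < A -> `|s| <= A -> `|t| <= 1 ->
  `|y| <= `|s * t| -> `|y| <= 2 -> `|y / t| <= 6 * log_majorant A t.
Proof.
move=> A0 sA t1 yst y2; have [->|t0] := eqVneq t 0.
  by rewrite invr0 mulr0 normr0 mulr_ge0// log_majorant_ge0 ?ltW.
have tp : 0 < `|t| by rewrite normr_gt0.
rewrite normrM normfV ler_pdivrMr//.
have : `|y| <= 3 * ((A * `|t|) / (1 + A * `|t|)).
  apply: le_min_ratio => //; first by rewrite mulr_ge0// ltW.
  by rewrite (le_trans yst)// normrM ler_wpM2r.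
move/le_trans; apply.
have -> : 6 * log_majorant A t * `|t| =
    3 * (A * `|t| / (1 + A * `|t|)) * (2 / (1 + `|t|)).
  rewrite /log_majorant; field.
  by rewrite !lt0r_neq0// ltr_wpDr// mulr_ge0// ltW.
rewrite ler_peMr//.
  have At : 0 <= A * `|t| by rewrite mulr_ge0// ltW.
  by rewrite mulr_ge0// divr_ge0// addr_ge0.
by rewrite ler_pdivlMr ?ltr_wpDr//; lra.
Qed.

(** As inside, but the factor 2 now comes from [1 <= 2 |t| / (1 + |t|)]. *)
Lemma log_majorant_outside (h t y : R) : 1 < `|t| ->
  `|y| <= `|h * t| -> `|y| <= 2 -> `|y / t ^+ 2| <= 6 * log_majorant `|h| t.
Proof.
move=> t1 yht y2.
have tp : 0 < `|t| by rewrite (lt_trans _ t1).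
rewrite normrM normfV normrX ler_pdivrMr ?exprn_gt0//.
have At : 0 <= `|h| * `|t| by rewrite mulr_ge0.
have : `|y| <= 3 * ((`|h| * `|t|) / (1 + `|h| * `|t|)).
  by apply: le_min_ratio; rewrite -?normrM.
move/le_trans; apply.
have -> : 6 * log_majorant `|h| t * `|t| ^+ 2 =
    3 * (`|h| * `|t| / (1 + `|h| * `|t|)) * (2 * `|t| / (1 + `|t|)).
  rewrite /log_majorant; field.
  by rewrite !lt0r_neq0// ltr_wpDr.
rewrite ler_peMr//.
by rewrite ler_pdivlMr ?ltr_wpDr//; lra.
Qed.

Lemma sqr_majorant_outside (t y c : R) : 1 < `|t| ->
  `|y| <= c -> `|y / t ^+ 2| <= 4 * c * sqr_majorant 1 t.
Proof.
move=> t1 yc.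
have tp : 0 < `|t| by rewrite (lt_trans _ t1).
have c0 : 0 <= c by rewrite (le_trans _ yc).
rewrite normrM normfV normrX ler_pdivrMr ?exprn_gt0//.
apply: (le_trans yc).
have -> : 4 * c * sqr_majorant 1 t * `|t| ^+ 2 = c * (2 * `|t| / (1 + `|t|)) ^+ 2.
  rewrite /sqr_majorant mul1r; field.
  by rewrite !lt0r_neq0// ltr_wpDr.
rewrite ler_peMr// expr_ge1// ?ler_pdivlMr ?ltr_wpDr//; last by lra.
Qed.

End ElementaryBounds.

(** * Measurability, and integrals over [-1, 1] depending on a parameter *)

Section UnderIntegral.
Context {R : realType}.
Notation mu := (@lebesgue_measure R).
Implicit Types (s t h : R) (a b : R -> R).

Lemma measurable_inv : measurable_fun setT (fun t : R => t^-1).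
Proof.
rewrite (_ : setT = [set~ 0] `|` [set (0 : R)]); last by rewrite setUC setUv.
have m0 : measurable [set (0 : R)] by exact: measurable_set1.
have oC : open [set~ (0 : R)].
  by rewrite openC; apply: accessible_closed_set1; exact: hausdorff_accessible.
apply/measurable_funU => //; first exact: open_measurable.
split; last exact: measurable_fun_set1.
apply: open_continuous_measurable_fun => // t; rewrite inE/= => /eqP t0.
exact: inv_continuous.
Qed.

Lemma measurable_cosM s : measurable_fun setT (fun t => cos (s * t)).
Proof.
apply: continuous_measurable_fun => t.
apply: (@continuous_comp _ _ _ ( *%R s) cos).
  exact: mulrl_continuous.
exact: continuous_cos.
Qed.

Lemma measurable_sinM s : measurable_fun setT (fun t => sin (s * t)).
Proof.
apply: continuous_measurable_fun => t.
apply: (@continuous_comp _ _ _ ( *%R s) sin).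
  exact: mulrl_continuous.
exact: continuous_sin.
Qed.

Lemma integrable_cst_itv1 (c : R) : mu.-integrable `[-1, 1] (EFin \o cst c).
Proof.
apply: continuous_compact_integrable; first exact: segment_compact.
by apply: continuous_subspaceT => x; exact: cvg_cst.
Qed.

Lemma bounded_integrable_itv1 (f : R -> R) (c : R) :
  measurable_fun setT f -> (forall t, -1 <= t <= 1 -> `|f t| <= c) ->
  mu.-integrable `[-1, 1] (EFin \o f).
Proof.
move=> mf fc.
apply: le_integrable (integrable_cst_itv1 c) => //.
  by apply/measurable_EFinP; exact: measurable_funTS.
move=> t; rewrite /= in_itv/= => /fc ftc.
by rewrite lee_fin (le_trans ftc)// ler_norm.
Qed.

Lemma is_derive_integral_itv1 (k dk : R -> R -> R) (C : R -> R) s :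
  (forall s, mu.-integrable `[-1, 1] (EFin \o k s)) ->
  (forall s t, is_derive s 1 (k ^~ t) (dk s t)) ->
  (forall B s t, `|s| <= B -> -1 <= t <= 1 -> `|dk s t| <= C B) ->
  is_derive s 1 (fun s => \int[mu]_(t in `[-1, 1]) k s t)
    (\int[mu]_(t in `[-1, 1]) dk s t).
Proof.
move=> ik kdk dkC.
have C0 : 0 <= C (`|s| + 1).
  have := dkC (`|s| + 1) s 0 (ler_wpDr ler01 (lexx _)).
  by rewrite oppr_le0 ler01 => /(_ isT); exact: le_trans.
have kE x y : partial1of2 k x y = dk x y.
  by rewrite partial1of2E; have [_ ->] := kdk x y.
have sI : `](s - 1), (s + 1)[%classic s by rewrite /= in_itv/=; lra.
have ik' x : `](s - 1), (s + 1)[%classic x ->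
  mu.-integrable `[-1, 1] (EFin \o k x) by move=> _; exact: ik.
have dk' x y : `](s - 1), (s + 1)[%classic x -> `[-1, 1]%classic y ->
  derivable (k^~ y) x 1 by move=> _ _; have [] := kdk x y.
have kC x y : `](s - 1), (s + 1)[%classic x -> `[-1, 1]%classic y ->
    `|partial1of2 k x y| <= cst (C (`|s| + 1)) y.
  rewrite /= !in_itv/= => xs y1; rewrite kE; apply: dkC => //.
  by rewrite -lerBlDl (le_trans (lerB_dist _ _))// ler_norml; lra.
have D := @differentiation_under_integral R _ _ mu k `[-1, 1]%classic (measurable_itv _) s _ _ sI
  ik' dk' _ (fun=> C0) (integrable_cst_itv1 _) kC.
apply: DeriveDef.
  exact: (@derivable_under_integral R _ _ mu k `[-1, 1]%classic (measurable_itv _) s _ _ sI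
  ik' dk' _ (fun=> C0) (integrable_cst_itv1 _) kC).
rewrite -derive1E D; apply: eq_Rintegral => t _; exact: kE.
Qed.

Lemma continuous_integral_itv1 (k : R -> R -> R) (C : R) :
  (forall s, measurable_fun setT (k s)) ->
  (forall t, continuous (k ^~ t)) ->
  (forall s t, -1 <= t <= 1 -> `|k s t| <= C) ->
  continuous (fun s => \int[mu]_(t in `[-1, 1]) k s t).
Proof.
move=> mk ck kC s.
have ik x : mu.-integrable `[-1, 1] (EFin \o k x).
  by apply: bounded_integrable_itv1 => // t; exact: kC.
have H := @continuity_under_integral R _ _ mu k `[-1, 1]%classic (measurable_itv _) (s - 1) (s + 1)
  (fun x _ => ik x).
have H1 : \forall y \ae mu, `[-1, 1]%classic y -> {in `](s - 1), (s + 1)[%classic, continuous (k^~ y)}.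
  by apply: aeW => y _ x _; exact: ck.
have H2 x : `](s - 1), (s + 1)[%classic x -> \forall y \ae mu, `[-1, 1]%classic y -> `|k x y| <= cst C y.
  by move=> _; apply: aeW => y; rewrite /= in_itv; exact: kC.
apply: (H H1 _ (integrable_cst_itv1 C) H2).
by rewrite inE/= in_itv/=; lra.
Qed.

End UnderIntegral.

(** * Contribution of [-1, 1] *)

Section LowFrequency.
Context {R : realType} (a b : R -> R) (M : R).
Notation mu := (@lebesgue_measure R).
Context (ma : measurable_fun setT a) (mb : measurable_fun setT b).
Context (aM : forall t, `|a t| <= M) (bM : forall t, `|b t| <= M) (a0 : a 0 = 0).
Implicit Types (s t h : R).

(* Taking [(a, b)] to be [(Re f, Im f)] or [(Im f, - Re f)] gives the real and
   imaginary parts of the integrals of [f] against complex kernels.  At [t = 0]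
   the quotients are 0 by convention, so [a 0 = 0] is needed to differentiate
   the kernels for every [t]. *)
Definition low_kernel s t :=
  (1 - cos (s * t)) / t ^+ 2 * a t + (s * t - sin (s * t)) / t ^+ 2 * b t.
Definition low_kernel1 s t :=
  sin (s * t) / t * a t + (1 - cos (s * t)) / t * b t.
Definition low_kernel2 s t := cos (s * t) * a t + sin (s * t) * b t.

Definition low_part s := \int[mu]_(t in `[-1, 1]) low_kernel s t.
Definition low_part1 s := \int[mu]_(t in `[-1, 1]) low_kernel1 s t.
Definition low_part2 s := \int[mu]_(t in `[-1, 1]) low_kernel2 s t.

Lemma weight_ge0 : 0 <= M. Proof. exact: le_trans (aM 0). Qed.

Lemma is_derive_cosM s t : is_derive s 1 (fun s => cos (s * t)) (- sin (s * t) * t).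
Proof.
have d1 : is_derive s 1 (fun s : R => s * t) t.
  by apply: is_derive_eq; rewrite /GRing.scale/=; ring.
exact: (is_derive1_comp (is_derive_cos _) d1).
Qed.

Lemma is_derive_sinM s t : is_derive s 1 (fun s => sin (s * t)) (cos (s * t) * t).
Proof.
have d1 : is_derive s 1 (fun s : R => s * t) t.
  by apply: is_derive_eq; rewrite /GRing.scale/=; ring.
exact: (is_derive1_comp (is_derive_sin _) d1).
Qed.

Lemma is_derive_low_kernel s t : is_derive s 1 (low_kernel ^~ t) (low_kernel1 s t).
Proof.
have d1 := is_derive_cosM s t; have d2 := is_derive_sinM s t.
rewrite /low_kernel; apply: is_derive_eq.
rewrite /low_kernel1 /GRing.scale/=.
have [->|t0] := eqVneq t 0; first by rewrite invr0 expr0n invr0; ring.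
field; exact: t0.
Qed.

Lemma is_derive_low_kernel1 s t : is_derive s 1 (low_kernel1 ^~ t) (low_kernel2 s t).
Proof.
have d1 := is_derive_cosM s t; have d2 := is_derive_sinM s t.
rewrite /low_kernel1; apply: is_derive_eq.
rewrite /low_kernel2 /GRing.scale/=.
(* At [t = 0] the kernel [low_kernel1] is constantly 0, whereas [low_kernel2] equals [a 0]. *)
have [->|t0] := eqVneq t 0; first by rewrite invr0 a0 !mulr0 sin0; ring.
field; exact: t0.
Qed.

Lemma measurable_low_kernels s :
  [/\ measurable_fun setT (low_kernel s), measurable_fun setT (low_kernel1 s)
    & measurable_fun setT (low_kernel2 s)].
Proof.
have mc := measurable_cosM s; have ms := measurable_sinM s.
have mi := @measurable_inv R.
have mi2 : measurable_fun setT (fun t : R => (t ^+ 2)^-1).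
  under eq_fun do rewrite -exprVn; exact: measurable_funX.
have mid : measurable_fun setT (fun t : R => s * t) by exact: mulrl_measurable.
have m1c : measurable_fun setT (fun t => 1 - cos (s * t)) by exact: measurable_funB.
have mts : measurable_fun setT (fun t => s * t - sin (s * t)) by exact: measurable_funB.
by split; apply: measurable_funD; apply: measurable_funM => //; exact: measurable_funM.
Qed.

Lemma weighted_sum_le (x y c t : R) : `|x| <= c -> `|y| <= c ->
  `|x * a t + y * b t| <= 2 * M * c.
Proof.
move=> xc yc; rewrite (le_trans (ler_normD _ _))// !normrM.
have h1 : `|x| * `|a t| <= c * M by exact: ler_pM.
have h2 : `|y| * `|b t| <= c * M by exact: ler_pM.
lra.
Qed.

Lemma low_kernel_le s t : `|low_kernel s t| <= 2 * M * s ^+ 2.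
Proof.
apply: weighted_sum_le; rewrite normrM normfV.
  have [->|t0] := eqVneq t 0; first by rewrite expr0n normr0 invr0 mulr0 sqr_ge0.
  rewrite ler_pdivrMr ?normr_gt0 ?expf_neq0//.
  by rewrite [`|t ^+ 2|]ger0_norm ?sqr_ge0// -exprMn norm_oneBcos_le_sqr.
have [->|t0] := eqVneq t 0; first by rewrite expr0n normr0 invr0 mulr0 sqr_ge0.
rewrite ler_pdivrMr ?normr_gt0 ?expf_neq0//.
by rewrite [`|t ^+ 2|]ger0_norm ?sqr_ge0// -exprMn norm_idBsin_le_sqr.
Qed.

Lemma low_kernel1_le s t : `|low_kernel1 s t| <= 2 * M * `|s|.
Proof.
apply: weighted_sum_le; rewrite normrM normfV.
  have [->|t0] := eqVneq t 0; first by rewrite normr0 invr0 mulr0.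
  by rewrite ler_pdivrMr ?normr_gt0// -normrM norm_sin_le.
have [->|t0] := eqVneq t 0; first by rewrite normr0 invr0 mulr0.
by rewrite ler_pdivrMr ?normr_gt0// -normrM norm_oneBcos_le.
Qed.

Lemma low_kernel2_le s t : `|low_kernel2 s t| <= 2 * M.
Proof.
rewrite -[leRHS]mulr1; apply: weighted_sum_le; [exact: cos_max|exact: sin_max].
Qed.

Lemma is_derive_low_part s : is_derive s 1 low_part (low_part1 s).
Proof.
have M0 := weight_ge0.
apply: (is_derive_integral_itv1 (C := fun B => 2 * M * B)).
- move=> x; apply: (@bounded_integrable_itv1 _ _ (2 * M * x ^+ 2)) => //.
    by case: (measurable_low_kernels x).
  by move=> t _; exact: low_kernel_le.
- exact: is_derive_low_kernel.
- move=> B x t xB _; rewrite (le_trans (low_kernel1_le _ _))// ler_wpM2l//.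
  by rewrite mulr_ge0.
Qed.

Lemma is_derive_low_part1 s : is_derive s 1 low_part1 (low_part2 s).
Proof.
apply: (is_derive_integral_itv1 (C := fun=> 2 * M)).
- move=> x; apply: (@bounded_integrable_itv1 _ _ (2 * M * `|x|)) => //.
    by case: (measurable_low_kernels x).
  by move=> t _; exact: low_kernel1_le.
- exact: is_derive_low_kernel1.
- by move=> B x t xB _; exact: low_kernel2_le.
Qed.

Lemma continuous_low_part2 : continuous low_part2.
Proof.
apply: (continuous_integral_itv1 (C := 2 * M)).
- by move=> x; case: (measurable_low_kernels x).
- move=> t x; rewrite /low_kernel2.
  have [/derivable1_diffP/differentiable_continuous c1 _] := is_derive_cosM x t.
  have [/derivable1_diffP/differentiable_continuous c2 _] := is_derive_sinM x t.
  exact: (cvgD (cvgM c1 (cvg_cst _)) (cvgM c2 (cvg_cst _))).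
- by move=> x t _; exact: low_kernel2_le.
Qed.

Lemma low_part2_le s : `|low_part2 s| <= 4 * M.
Proof.
have ik c : mu.-integrable `[-1, 1] (EFin \o cst c) := integrable_cst_itv1 c.
have i2 : mu.-integrable `[-1, 1] (EFin \o low_kernel2 s).
  apply: (@bounded_integrable_itv1 _ _ (2 * M)) => //.
    by case: (measurable_low_kernels s).
  by move=> t _; exact: low_kernel2_le.
apply: le_trans; first by apply: le_normr_Rintegral.
apply: (@le_trans _ _ (\int[mu]_(t in `[-1, 1]) (2 * M))).
  apply: le_Rintegral => //; first exact: integrable_norm.
  - exact: ik.
  - by move=> t _; exact: low_kernel2_le.
rewrite Rintegral_cst; last exact: measurable_itv.
rewrite [X in fine X](_ : _ = 2%:E); first by rewrite /=; lra.
transitivity (mu `[-1, 1]%classic) => //.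
by rewrite lebesgue_measure_itv/= lte_fin ifT -?EFinD; [congr EFin; lra|lra].
Qed.

(* The factor [log (|s| + 2)] comes from [min(|s|, 2 / |t|)], integrated over [-1, 1]. *)
Lemma low_part1_le s : `|low_part1 s| <= 48 * M * ln (`|s| + 2).
Proof.
have M0 := weight_ge0.
have A1 : 1 < `|s| + 2 by rewrite (lt_le_trans (ltr1n _ 2))// lerDr.
have A0 : 0 < `|s| + 2 by rewrite (lt_trans _ A1).
have An1 : `|s| + 2 != 1 by rewrite gt_eqF.
have [iL intL] := integrable_log_majorant A0 An1.
have [_ ms _] := measurable_low_kernels s.
have K t : `[-1, 1]%classic t ->
    `|low_kernel1 s t| <= 12 * M * log_majorant (`|s| + 2) t.
  rewrite /= in_itv/= => t1.
  have t1' : `|t| <= 1 by rewrite ler_norml.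
  have sA : `|s| <= `|s| + 2 by rewrite lerDl.
  have -> : 12 * M * log_majorant (`|s| + 2) t = 2 * M * (6 * log_majorant (`|s| + 2) t) by ring.
  by apply: weighted_sum_le; apply: (log_majorant_inside A0 sA t1');
    rewrite ?norm_sin_le ?norm_oneBcos_le ?norm_sin_le2 ?norm_oneBcos_le2.
have [_] := @majorized_Rintegral R `[-1, 1]%classic (low_kernel1 s)
  (log_majorant (`|s| + 2)) (12 * M) (measurable_itv _) (measurable_funTS ms) iL
  (fun t => log_majorant_ge0 _ (ltW A0)) (mulr_ge0 (ler0n _ _) M0) K.
move=> /le_trans; apply; rewrite intL.
(* One factor 2 is in the integral of [log_majorant]; the other bounds [A / (A - 1)] for
   [A = |s| + 2 >= 2]. *)
have -> : 48 * M * ln (`|s| + 2) = 12 * M * (2 * (2 * ln (`|s| + 2))) by ring.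
have L0 : 0 <= ln (`|s| + 2) by rewrite ln_ge0// ltW.
rewrite ler_wpM2l ?mulr_ge0// ler_wpM2l// ler_wpM2r//.
rewrite ler_pdivrMr; last by rewrite subr_gt0.
have := normr_ge0 s; lra.
Qed.

Lemma low_part0 : low_part 0 = 0.
Proof.
rewrite /low_part (_ : (fun t => _) = cst 0); last first.
  by apply/funext => t; rewrite /low_kernel mul0r cos0 sin0 !subrr !mul0r addr0.
by rewrite Rintegral_cst ?mul0r//; exact: measurable_itv.
Qed.

Lemma low_part1_0 : low_part1 0 = 0.
Proof.
rewrite /low_part1 (_ : (fun t => _) = cst 0); last first.
  by apply/funext => t; rewrite /low_kernel1 mul0r cos0 sin0 !subrr !mul0r addr0.
by rewrite Rintegral_cst ?mul0r//; exact: measurable_itv.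
Qed.

(** Integrates the bound on [low_part2] from 0, where [low_part1] vanishes. Polynomial growth is all
    that pairing with Schwartz functions requires; the logarithmic bound is kept for the modulus of
    continuity. *)
Lemma low_part1_growth s : `|low_part1 s| <= 4 * M * `|s|.
Proof.
have := @mean_value_le R low_part1 low_part2 0 s (4 * M) is_derive_low_part1.
by rewrite low_part1_0 !subr0; apply => x _; exact: low_part2_le.
Qed.

Lemma low_part_growth s : `|low_part s| <= 4 * M * `|s| ^+ 2.
Proof.
have := @mean_value_le R low_part low_part1 0 s (4 * M * `|s|) is_derive_low_part.
rewrite low_part0 !subr0 expr2 mulrA; apply => x /andP[x1 x2].
rewrite (le_trans (low_part1_growth _))// ler_wpM2l ?mulr_ge0 ?weight_ge0//.
rewrite ler_norml; move: x1 x2; rewrite ge_min le_max.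
have := ler_norm s; have := ler_norm (- s); rewrite normrN.
by move=> ? ? /orP[?|?] /orP[?|?]; lra.
Qed.

(** Points between [s] and [s + h] have modulus at most [|s| + 1], and [low_part1_le] adds 2. *)
Lemma low_part_modulus s h : `|h| <= 1 ->
  `|low_part (s + h) - low_part s| <= 48 * M * ln (`|s| + 3) * `|h|.
Proof.
move=> h1.
have := @mean_value_le R low_part low_part1 s (s + h) (48 * M * ln (`|s| + 3)) is_derive_low_part.
rewrite [s + h - s]addrC addKr; apply => x /andP[x1 x2].
rewrite (le_trans (low_part1_le _))// ler_wpM2l ?mulr_ge0 ?weight_ge0//.
have x3 : `|x| <= `|s| + 1.
  have := ler_norm s; have := ler_norm (- s); rewrite normrN.
  move: h1; rewrite ler_norml => /andP[? ?].
  move: x1 x2; rewrite ge_min le_max ler_norml.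
  by move=> /orP[?|?] /orP[?|?] ? ?; lra.
rewrite ler_ln ?posrE; first by lra.
  by rewrite ltr_wpDl.
by rewrite ltr_wpDl.
Qed.

End LowFrequency.

Lemma expR1_inv_le_half (R : realType) : (expR 1)^-1 <= 2^-1 :> R.
Proof.
by rewrite lef_pV2 ?posrE ?expR_gt0//; have := expR_ge1Dx (1 : R); lra.
Qed.

(** * Contribution of [|t| > 1] *)

Section HighFrequency.
Context {R : realType} (a b : R -> R) (M : R).
Notation mu := (@lebesgue_measure R).
Context (ma : measurable_fun setT a) (mb : measurable_fun setT b).
Context (aM : forall t, `|a t| <= M) (bM : forall t, `|b t| <= M).
Implicit Types (s t h : R).

Definition high_kernel s t := (cos (s * t) * a t + sin (s * t) * b t) / t ^+ 2.
Definition high_part s := \int[mu]_(t in [set t | 1 < `|t|]) high_kernel s t.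

Lemma measurable_outside : measurable [set t : R | 1 < `|t|].
Proof.
apply: open_measurable.
rewrite (_ : mkset _ = Num.norm @^-1` [set x : R | 1 < x])//.
apply: open_comp; last exact: open_gt.
by move=> x _; exact: norm_continuous.
Qed.

Lemma measurable_high_kernel s : measurable_fun setT (high_kernel s).
Proof.
have mc := measurable_cosM s; have ms := measurable_sinM s.
have mi := @measurable_inv R.
have mi2 : measurable_fun setT (fun t : R => (t ^+ 2)^-1).
  under eq_fun do rewrite -exprVn; exact: measurable_funX.
by apply: measurable_funM => //; apply: measurable_funD; exact: measurable_funM.
Qed.

Lemma high_kernel_le s t : 1 < `|t| ->
  `|high_kernel s t| <= 8 * M * sqr_majorant 1 t.
Proof.
move=> t1.
have -> : 8 * M * sqr_majorant 1 t = 4 * (2 * M) * sqr_majorant 1 t by ring.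
apply: sqr_majorant_outside => //.
(* The numerator of [high_kernel] is [low_kernel2]. *)
by have := low_kernel2_le aM bM s t.
Qed.

Lemma high_part_integrable_le s :
  mu.-integrable [set t | 1 < `|t|] (EFin \o high_kernel s) /\
  `|high_part s| <= 16 * M.
Proof.
have M0 : 0 <= M by exact: le_trans (aM 0).
have [iL intL] := integrable_sqr_majorant (@ltr01 R).
have [iK] := majorized_Rintegral measurable_outside
  (measurable_funTS (measurable_high_kernel s)) iL
  (fun t => sqr_majorant_ge0 _ ler01) (mulr_ge0 (ler0n _ 8) M0) (@high_kernel_le s).
split => //.
have -> : 16 * M = 8 * M * \int[mu]_t sqr_majorant 1 t by rewrite intL; ring.
by [].
Qed.

(** The difference of kernels is dominated by [log_majorant] with parameter [|h|], whose integral is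
    [2 |h| / (1 - |h|)] times [- ln |h|]. The restriction on [h] gives [|h| <= 1/2], hence
    [1 / (1 - |h|) <= 2]. *)
Lemma high_part_modulus s h : 0 < `|h| <= (expR 1)^-1 ->
  `|high_part (s + h) - high_part s| <= 48 * M * (`|h| * `|ln `|h| |).
Proof.
move=> /andP[h0 he]; have M0 : 0 <= M by exact: le_trans (aM 0).
have h2 : `|h| <= 2^-1 by rewrite (le_trans he)// expR1_inv_le_half.
have h1 : `|h| != 1 by rewrite lt_eqF//; lra.
have [iL intL] := integrable_log_majorant h0 h1.
have [i1 _] := high_part_integrable_le (s + h).
have [i2 _] := high_part_integrable_le s.
rewrite /high_part -RintegralB//; last exact: measurable_outside.
have K t : 1 < `|t| -> `|high_kernel (s + h) t - high_kernel s t| <=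
    12 * M * log_majorant `|h| t.
  move=> t1.
  have -> : high_kernel (s + h) t - high_kernel s t =
    (cos ((s + h) * t) - cos (s * t)) / t ^+ 2 * a t +
    (sin ((s + h) * t) - sin (s * t)) / t ^+ 2 * b t.
    by rewrite /high_kernel; ring.
  have -> : 12 * M * log_majorant `|h| t = 2 * M * (6 * log_majorant `|h| t) by ring.
  have E : (s + h) * t - s * t = h * t by ring.
  apply: weighted_sum_le => //; apply: log_majorant_outside => //.
  - by rewrite -E cos_lipschitz.
  - by rewrite (le_trans (ler_normB _ _))// (le_trans (lerD (cos_max _) (cos_max _))).
  - by rewrite -E sin_lipschitz.
  - by rewrite (le_trans (ler_normB _ _))// (le_trans (lerD (sin_max _) (sin_max _))).
have mB : measurable_fun setT (fun t => high_kernel (s + h) t - high_kernel s t).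
  by apply: measurable_funB; exact: measurable_high_kernel.
have [_ H] := majorized_Rintegral measurable_outside (measurable_funTS mB) iL
  (fun t => log_majorant_ge0 _ (normr_ge0 h)) (mulr_ge0 (ler0n _ 12) M0) K.
apply: (le_trans H); rewrite intL.
have -> : 48 * M * (`|h| * `|ln `|h| |) = 12 * M * (2 * (2 * `|h| * `|ln `|h| |)) by ring.
rewrite ler_wpM2l ?mulr_ge0// ler_wpM2l//.
rewrite [`|ln _|]ler0_norm; last by rewrite ln_le0//; lra.
have -> : `|h| / (`|h| - 1) * ln `|h| = `|h| / (1 - `|h|) * - ln `|h|.
  field; apply/andP; split; apply/eqP; lra.
rewrite ler_wpM2r; first by [].
  by rewrite oppr_ge0 ln_le0//; lra.
rewrite ler_pdivrMr; last by lra.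
nra.
Qed.

Lemma continuous_high_part : continuous high_part.
Proof.
move=> s; have M0 : 0 <= M by exact: le_trans (aM 0).
have [iL _] := integrable_sqr_majorant (@ltr01 R).
have ig : mu.-integrable [set t | 1 < `|t|] (EFin \o (fun t => 8 * M * sqr_majorant 1 t)).
  apply: (integrableS measurableT) => //; first exact: measurable_outside.
  rewrite (_ : EFin \o _ = (fun t => (8 * M)%:E * (EFin \o sqr_majorant 1) t)%E).
    exact: integrableZl.
  by apply/funext => t; rewrite /= EFinM.
apply: (@continuity_under_integral R _ _ mu high_kernel _ measurable_outside
  (s - 1) (s + 1) _ _ (fun t => 8 * M * sqr_majorant 1 t) ig).
- by move=> x _; have [] := high_part_integrable_le x.
- apply: aeW => t _ x _.
  have [/derivable1_diffP/differentiable_continuous c1 _] := is_derive_cosM x t.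
  have [/derivable1_diffP/differentiable_continuous c2 _] := is_derive_sinM x t.
  exact: (cvgM (cvgD (cvgM c1 (cvg_cst _)) (cvgM c2 (cvg_cst _))) (cvg_cst _)).
- by move=> x _; apply: aeW => t; exact: high_kernel_le.
- by rewrite inE/= in_itv/=; lra.
Qed.

End HighFrequency.

(** * Schwartz functions on the line *)

Section IntegrationByParts.
Context {R : realType}.
Notation mu := (@lebesgue_measure R).

Lemma cvg_integral_symmetric (f : R -> R) :
  mu.-integrable setT (EFin \o f) ->
  \int[mu]_(x in `[- n%:R, n%:R]) f x @[n --> \oo] --> \int[mu]_x f x.
Proof.
move=> fi; have mf := measurable_int _ fi.
pose f_ n := (EFin \o f) \_ `[- (n%:R : R), n%:R].
have mf_ n : measurable_fun setT (f_ n).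
  by apply/(measurable_restrictT _ _).1 => //; exact: measurable_funS mf.
have cf : {ae mu, forall x, setT x -> f_ ^~ x @ \oo --> (EFin \o f) x}.
  apply: aeW => x _; apply: cvg_near_cst; near=> n.
  rewrite /f_ patchE mem_set//= in_itv/=.
  by rewrite -ler_norml; near: n; exact: nbhs_infty_ger.
have df : {ae mu, forall x n, setT x -> (`|f_ n x| <= (abse \o (EFin \o f)) x)%E}.
  apply: aeW => x n _; rewrite /f_ patchE; case: ifP => //= _.
  by rewrite normr0 lee_fin.
have fai : mu.-integrable setT (abse \o (EFin \o f)) by exact: integrable_abse.
have [_ _ H] := @dominated_convergence _ _ _ mu setT measurableT _ _ _ mf_ mf cf fai df.
apply: fine_cvg; rewrite fineK; last exact: integrable_fin_num.
apply: cvg_trans H; apply: near_eq_cvg; near=> n.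
by rewrite /f_ integral_mkcond.
Unshelve. all: by end_near. Qed.

(** On [[-n, n]] the integral is [F n - F (-n)], which is [O(1 / n)]; the bound on [f] makes these
    integrals converge to the one over the line. It serves both the integration by parts and the
    vanishing of the integral of the curvature. *)
Lemma Rintegral_derivative_eq0 (F f : R -> R) (c : R) :
  0 <= c ->
  (forall x : R, is_derive x 1 F (f x)) -> continuous f ->
  (forall x, `|f x| <= c * sqr_majorant 1 x) ->
  (forall x, `|F x| * (1 + `|x|) <= c) ->
  \int[mu]_x f x = 0.
Proof.
move=> c0 Ff cf fc Fc.
have [iL _] := integrable_sqr_majorant (@ltr01 R).
have [fi _] := majorized_Rintegral measurableT (continuous_measurable_fun cf) iL
  (fun t => sqr_majorant_ge0 _ ler01) c0 (fun x _ => fc x).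
apply: (cvg_unique (@norm_hausdorff _ _) (cvg_integral_symmetric fi)).
have FE n : (0 < n)%N -> \int[mu]_(x in `[- n%:R, n%:R]) f x = F n%:R - F (- n%:R).
  move=> n0.
  have cF : continuous F.
    by move=> x; apply: differentiable_continuous; apply/derivable1_diffP; have [] := Ff x.
  rewrite /Rintegral (@continuous_FTC2 _ f F)//.
  - have nR : (0 : R) < n%:R by rewrite ltr0n.
    by rewrite (lt_trans _ nR)// oppr_lt0.
  - exact: continuous_subspaceT.
  - split.
    + by move=> x _; have [] := Ff x.
    + by apply: cvg_at_right_filter; exact: cF.
    + by apply: cvg_at_left_filter; exact: cF.
  - by move=> x _; rewrite derive1E; have [_ ->] := Ff x.
apply/cvgrPdist_le => e e0; near=> n.
have n0 : (0 < n)%N by near: n; exact: nbhs_infty_gt.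
rewrite FE// sub0r normrN.
have ne : 2 * c / e <= n%:R by near: n; exact: nbhs_infty_ger.
have nR : (0 : R) < n%:R by rewrite ltr0n.
move: ne; rewrite ler_pdivrMr// => ne.
have := Fc n%:R; have := Fc (- n%:R); rewrite normrN (ger0_norm (ltW nR)) => F1 F2.
apply: (le_trans (ler_normB _ _)).
rewrite -(ler_pM2r nR) mulrDl mulrC.
have := normr_ge0 (F n%:R); have := normr_ge0 (F (- n%:R)); nra.
Unshelve. all: by end_near. Qed.

(** The weight [1 + |x|], unlike the [|x|] of [schwartz], is at least 1, so a single bound controls
    a function near 0 and at infinity. *)
Definition real_schwartz (p : R -> R) :=
  (forall (n : nat) (x : R), derivable (derive1n n p) x 1) /\
  forall k n : nat, exists C, forall x : R, (1 + `|x|) ^+ k * `|derive1n n p x| <= C.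

Lemma real_schwartz_is_derive (p : R -> R) n (x : R) : real_schwartz p ->
  is_derive x 1 (derive1n n p) (derive1n n.+1 p x).
Proof.
move=> [dp _]; apply: DeriveDef; first exact: dp.
by rewrite derive1nS derive1E.
Qed.

Lemma real_schwartz_continuous (p : R -> R) n : real_schwartz p ->
  continuous (derive1n n p).
Proof.
by move=> [dp _] x; apply: differentiable_continuous; apply/derivable1_diffP.
Qed.

(** Of the [k + 2] powers of decay, [k] absorb the growth of [u] and two become [sqr_majorant 1]. *)
Lemma real_schwartz_majorized (u p : R -> R) k n c : real_schwartz p ->
  (forall x, `|u x| <= c * (1 + `|x|) ^+ k) ->
  exists2 C, 0 <= C & forall x, `|u x * derive1n n p x| <= C * sqr_majorant 1 x.
Proof.
move=> [_ dp] uc; have [C HC] := dp (k + 2)%N n.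
have c0 : 0 <= c.
  by have := le_trans (normr_ge0 _) (uc 0); rewrite normr0 addr0 expr1n mulr1.
have C0 : 0 <= C by apply: le_trans (HC 0); rewrite mulr_ge0// exprn_ge0// addr_ge0.
exists (c * C); first exact: mulr_ge0.
move=> x; rewrite normrM /sqr_majorant !mul1r.
have p0 : 0 < 1 + `|x| by rewrite ltr_wpDr.
rewrite ler_pdivlMr ?exprn_gt0//.
rewrite mulrAC; apply: (@le_trans _ _ (c * (1 + `|x|) ^+ k * (1 + `|x|) ^+ 2 * `|derive1n n p x|)).
  by rewrite ler_wpM2r// ler_wpM2r ?exprn_ge0// ltW.
by have := ler_wpM2l c0 (HC x); rewrite exprD !mulrA.
Qed.

Lemma real_schwartz_integrable (u p : R -> R) k n c : real_schwartz p ->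
  measurable_fun setT u -> (forall x, `|u x| <= c * (1 + `|x|) ^+ k) ->
  mu.-integrable setT (EFin \o (fun x => u x * derive1n n p x)).
Proof.
move=> sp mu_ uc; have [C C0 HC] := real_schwartz_majorized n sp uc.
have [iL _] := integrable_sqr_majorant (@ltr01 R).
have m : measurable_fun setT (fun x => u x * derive1n n p x).
  apply: measurable_funM => //.
  by apply: continuous_measurable_fun; exact: real_schwartz_continuous.
by have [] := majorized_Rintegral measurableT m iL
  (fun t => sqr_majorant_ge0 _ ler01) C0 (fun x _ => HC x).
Qed.

(** Both integrations by parts happen at once: [u p'' - u2 p] is the derivative of [u p' - u1 p],
    which decays at infinity. *)
Lemma integration_by_parts_schwartz (u u1 u2 p : R -> R) c :
  (forall x : R, is_derive x 1 u (u1 x)) -> (forall x : R, is_derive x 1 u1 (u2 x)) ->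
  continuous u2 ->
  (forall x, `|u x| <= c * (1 + `|x|) ^+ 2) ->
  (forall x, `|u1 x| <= c * (1 + `|x|) ^+ 2) ->
  (forall x, `|u2 x| <= c * (1 + `|x|) ^+ 2) -> real_schwartz p ->
  \int[mu]_x (u x * derive1n 2 p x) = \int[mu]_x (u2 x * p x).
Proof.
move=> du du1 cu2 uc u1c u2c sp.
have dc (v v' : R -> R) : (forall x : R, is_derive x 1 v (v' x)) -> continuous v.
  by move=> dv x; apply: differentiable_continuous; apply/derivable1_diffP; have [] := dv x.
have cu := dc _ _ du; have cu1 := dc _ _ du1.
have cp n := @real_schwartz_continuous p n sp.
have i1 := real_schwartz_integrable 2 sp (continuous_measurable_fun cu) uc.
have i2 := real_schwartz_integrable 0 sp (continuous_measurable_fun cu2) u2c.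
have [C1 C10 H1] := real_schwartz_majorized 2 sp uc.
have [C2 C20 H2] := real_schwartz_majorized 0 sp u2c.
have [C3 C30 H3] := real_schwartz_majorized 1 sp uc.
have [C4 C40 H4] := real_schwartz_majorized 0 sp u1c.
apply/eqP; rewrite -subr_eq0 -RintegralB//; apply/eqP.
apply: (@Rintegral_derivative_eq0 (fun x => u x * derive1n 1 p x - u1 x * p x) _ (C1 + C2 + C3 + C4)).
- by rewrite !addr_ge0.
- move=> x; have d0 := real_schwartz_is_derive 0 x sp.
  have d1 := real_schwartz_is_derive 1 x sp.
  have D := is_deriveB (is_deriveM (du x) d1) (is_deriveM (du1 x) d0).
  apply: (is_derive_eq D); rewrite /GRing.scale/=; ring.
- move=> x; apply: cvgB; apply: cvgM; [exact: cu|exact: (cp 2)|exact: cu2|exact: (cp 0)].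
- move=> x; have m0 := sqr_majorant_ge0 x (@ler01 R).
  rewrite (le_trans (ler_normB _ _))// (le_trans (lerD (H1 x) (H2 x)))//.
  by rewrite -mulrDl ler_wpM2r// -addrA lerDl addr_ge0.
- move=> x; have p0 : 0 < 1 + `|x| by rewrite ltr_wpDr.
  rewrite -ler_pdivlMr// (le_trans (ler_normB _ _))//.
  rewrite (le_trans (lerD (H3 x) (H4 x)))// -mulrDl.
  have m1 : sqr_majorant 1 x <= (1 + `|x|)^-1.
    rewrite /sqr_majorant !mul1r lef_pV2 ?posrE ?exprn_gt0// expr2.
    by rewrite ler_pMr// lerDl.
  apply: ler_pM => //; [exact: addr_ge0|exact: sqr_majorant_ge0|].
  by rewrite -addrA lerDr addr_ge0.
Qed.
End IntegrationByParts.

(** * Assembling the complex-valued primitive *)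

Section ComplexValued.
Context {R : realType}.
Notation mu := (@lebesgue_measure R).
Implicit Types (z w : R[i]).

Lemma normc_ge_Re z : `|complex.Re z| <= Normc.normc z.
Proof.
case: z => x y /=; rewrite -sqrtr_sqr; apply: ler_wsqrtr.
by rewrite lerDl sqr_ge0.
Qed.

Lemma normc_ge_Im z : `|complex.Im z| <= Normc.normc z.
Proof.
case: z => x y /=; rewrite -sqrtr_sqr; apply: ler_wsqrtr.
by rewrite lerDr sqr_ge0.
Qed.

Lemma normc_le_ReIm z : Normc.normc z <= `|complex.Re z| + `|complex.Im z|.
Proof.
case: z => x y /=; rewrite -[leRHS]ger0_norm ?addr_ge0// -sqrtr_sqr.
apply: ler_wsqrtr; rewrite sqrrD !real_normK ?num_real// -mulr_natr.
have : 0 <= `|x| * `|y| by rewrite mulr_ge0.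
lra.
Qed.

Lemma ReM z w : complex.Re (z * w) =
  complex.Re z * complex.Re w - complex.Im z * complex.Im w.
Proof. by case: z w => [? ?] [? ?]. Qed.

Lemma ImM z w : complex.Im (z * w) =
  complex.Re z * complex.Im w + complex.Im z * complex.Re w.
Proof. by case: z w => [? ?] [? ?]. Qed.

Lemma ReB z w : complex.Re (z - w) = complex.Re z - complex.Re w.
Proof. by case: z w => [? ?] [? ?]. Qed.

Lemma ImB z w : complex.Im (z - w) = complex.Im z - complex.Im w.
Proof. by case: z w => [? ?] [? ?]. Qed.

Lemma Re_divr z (r : R) : complex.Re (z / r%:C) = complex.Re z / r.
Proof. by rewrite -fmorphV ReM /= mulr0 subr0. Qed.

Lemma Im_divr z (r : R) : complex.Im (z / r%:C) = complex.Im z / r.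
Proof. by rewrite -fmorphV ImM /= mulr0 add0r. Qed.

Lemma Re_expiM (x : R) z : complex.Re (expi (- x) * z) =
  cos x * complex.Re z + sin x * complex.Im z.
Proof. by rewrite ReM /= cosN sinN mulNr opprK. Qed.

Lemma Im_expiM (x : R) z : complex.Im (expi (- x) * z) =
  cos x * complex.Im z + sin x * (- complex.Re z).
Proof. by rewrite ImM /= cosN sinN mulNr mulrN. Qed.

(** A positive [e] in [R[i]] is real and positive, so the usual argument with halves runs on
    [complex.Re e]. *)
Lemma continuous_complex (F : R -> R[i]) :
  continuous (fun s => complex.Re (F s)) -> continuous (fun s => complex.Im (F s)) ->
  continuous (F : R -> R[i]^o).
Proof.
move=> cR cI s; apply/cvgrPdist_lt => /= e; rewrite ltcE/= => /andP[/eqP eI e0].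
have e2 : 0 < complex.Re e / 2 by rewrite divr_gt0.
have /cvgrPdist_lt/(_ _ e2) HR := cR s.
have /cvgrPdist_lt/(_ _ e2) HI := cI s.
near=> t.
have tR : `|complex.Re (F s) - complex.Re (F t)| < complex.Re e / 2 by near: t.
have tI : `|complex.Im (F s) - complex.Im (F t)| < complex.Re e / 2 by near: t.
rewrite ltcE/= eI eqxx/=.
apply: (le_lt_trans (normc_le_ReIm _)).
by rewrite ReB ImB; lra.
Unshelve. all: by end_near. Qed.

Lemma schwartz_real_schwartz (phi : R -> R[i]) : schwartz phi ->
  real_schwartz (fun x => complex.Re (phi x)) /\
  real_schwartz (fun x => complex.Im (phi x)).
Proof.
move=> [sphi dphi].
have H (g : nat -> R -> R) : (forall n x, `|g n x| <= Normc.normc (cderiven n phi x)) ->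
    forall k n : nat, exists C, forall x : R, (1 + `|x|) ^+ k * `|g n x| <= C.
  move=> gle k n; have [C0 H0] := dphi 0%N n; have [Ck Hk] := dphi k n.
  exists (2 ^+ k * (C0 + Ck)) => x.
  (* Because [1 + |x|] is at most twice the larger of 1 and [|x|]. *)
  have xk : (1 + `|x|) ^+ k <= 2 ^+ k * (1 + `|x| ^+ k).
    have [x1|x1] := leP `|x| 1.
      rewrite (@le_trans _ _ (2 ^+ k))//.
        by rewrite lerXn2r ?nnegrE ?addr_ge0//; lra.
      by rewrite ler_peMr ?exprn_ge0// lerDl exprn_ge0.
    rewrite (@le_trans _ _ ((2 * `|x|) ^+ k))//.
      by rewrite lerXn2r ?nnegrE ?addr_ge0 ?mulr_ge0//; lra.
    by rewrite exprMn ler_wpM2l ?exprn_ge0// lerDr.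
  apply: (@le_trans _ _ (2 ^+ k * (1 + `|x| ^+ k) * Normc.normc (cderiven n phi x))).
    by rewrite ler_pM// exprn_ge0// addr_ge0.
  rewrite -mulrA ler_wpM2l ?exprn_ge0// mulrDl lerD//.
  by have := H0 x; rewrite expr0.
split; split => [n x|].
- exact: (sphi n x).1.
- apply: (H (fun n => derive1n n (fun x => complex.Re (phi x)))) => n x.
  exact: (normc_ge_Re (cderiven n phi x)).
- exact: (sphi n x).2.
- apply: (H (fun n => derive1n n (fun x => complex.Im (phi x)))) => n x.
  exact: (normc_ge_Im (cderiven n phi x)).
Qed.

Lemma Rintegral_ae_eq (D : set R) (f g : R -> R) : measurable D ->
  measurable_fun setT f -> measurable_fun setT g ->
  {ae mu, forall t, f t = g t} ->
  \int[mu]_(t in D) f t = \int[mu]_(t in D) g t.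
Proof.
move=> mD mf mg fg; rewrite /Rintegral; congr fine; apply: ae_eq_integral => //.
- by apply/measurable_EFinP; exact: measurable_funTS.
- by apply/measurable_EFinP; exact: measurable_funTS.
- case: fg => N [mN N0 sub]; exists N; split => // t /= tN.
  by apply: sub => /= ftg; apply: tN => _; rewrite ftg.
Qed.

End ComplexValued.

(** * Passing to a representative that is bounded everywhere *)

Section Transform.
Context {R : realType}.
Notation mu := (@lebesgue_measure R).

Lemma ae_normc_le_Linfty_norm (f : R -> R[i]) : Linfty f ->
  0 <= Linfty_norm f /\
  {ae mu, forall t, Normc.normc (f t) <= Linfty_norm f}.
Proof.
move=> [_ ff].
have f0 : (0 <= Linfty_enorm f)%E by exact: Lnorm_ge0.
have E : Linfty_enorm f = (Linfty_norm f)%:E.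
  by rewrite /Linfty_norm fineK// ge0_fin_numE.
split; first exact: fine_ge0.
have : (Linfty_enorm f <= (Linfty_norm f)%:E)%E by rewrite E.
(* For exponent [+oo] the norm unfolds to the essential supremum once the whole line is known to
   have positive measure. *)
rewrite {1}/Linfty_enorm unlock ifT; last first.
  have := lebesgue_measure_itv (R := R) `]-oo, +oo[.
  rewrite set_itvNyy /= => ->; exact: ltry.
move/ess_supP => [N [mN N0 sub]]; exists N; split => // t /= tN.
apply: sub => /=; rewrite lee_fin => H; apply: tN.
by rewrite (le_trans (ler_norm _)).
Qed.

(* The value 0 at [t = 0] matches the convention [x / 0 = 0] in the kernels. *)
Definition truncate (f : R -> R[i]) t : R[i] :=
  if (complex.Re (f t) ^+ 2 + complex.Im (f t) ^+ 2 <= Linfty_norm f ^+ 2)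
     && (t != 0)
  then f t else 0.

Lemma truncateP (f : R -> R[i]) : Linfty f ->
  [/\ cmeasurable (truncate f),
      forall t, Normc.normc (truncate f t) <= Linfty_norm f,
      truncate f 0 = 0 & {ae mu, forall t, f t = truncate f t}].
Proof.
move=> Lf; have [M0 aeM] := ae_normc_le_Linfty_norm Lf.
have [[mR mI] _] := Lf.
split.
(* Comparing squares keeps the square root of the modulus out of the measurability argument. *)
- have mq : measurable_fun setT
      (fun t => complex.Re (f t) ^+ 2 + complex.Im (f t) ^+ 2).
    by apply: measurable_funD; exact: measurable_funX.
  have mb : measurable_fun setT (fun t =>
      (complex.Re (f t) ^+ 2 + complex.Im (f t) ^+ 2 <= Linfty_norm f ^+ 2)
     && (t != 0)).
    apply: measurable_and.
      exact: measurable_fun_ler.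
    by apply: measurable_neg; exact: measurable_fun_eqr.
  split.
  + rewrite (_ : (fun t => _) = (fun t => if (complex.Re (f t) ^+ 2 + complex.Im (f t) ^+ 2 <= Linfty_norm f ^+ 2)
     && (t != 0) then complex.Re (f t) else 0)); last first.
      by apply/funext => t; rewrite /truncate; case: ifP.
    exact: measurable_fun_ifT.
  + rewrite (_ : (fun t => _) = (fun t => if (complex.Re (f t) ^+ 2 + complex.Im (f t) ^+ 2 <= Linfty_norm f ^+ 2)
     && (t != 0) then complex.Im (f t) else 0)); last first.
      by apply/funext => t; rewrite /truncate; case: ifP.
    exact: measurable_fun_ifT.
- move=> t; rewrite /truncate; case: ifP => [/andP[+ _]|_]; last by rewrite Normc.normc0.
  move: (f t) => [x y] /= xy; rewrite -[leRHS]ger0_norm// -sqrtr_sqr.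
  exact: ler_wsqrtr.
- by rewrite /truncate eqxx andbF.
- have [N [mN N0 sub]] := aeM.
  exists (N `|` [set 0]); split.
  + by apply: measurableU => //; exact: measurable_set1.
  + apply: (@null_set_setU _ _ _ mu) => //; exact: lebesgue_measure_set1.
  + move=> t /= tf; have [->|t0] := eqVneq t 0; [by right|left].
    apply: sub => /= ft; apply: tf; rewrite /truncate t0 andbT ifT//.
    move: (f t) ft => [x y] /= xy.
    by rewrite -[leLHS]sqr_sqrtr ?addr_ge0 ?sqr_ge0// ler_sqr ?nnegrE ?sqrtr_ge0.
Qed.

Lemma measurable_low_kernel2 (a b : R -> R) s :
  measurable_fun setT a -> measurable_fun setT b ->
  measurable_fun setT (low_kernel2 a b s).
Proof. by move=> ma mb; have [] := measurable_low_kernels ma mb s. Qed.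

Lemma fhat1E (f : R -> R[i]) s : fhat1 f s =
  low_part2 (fun t => complex.Re (f t)) (fun t => complex.Im (f t)) s +i*
  low_part2 (fun t => complex.Im (f t)) (fun t => - complex.Re (f t)) s.
Proof.
by congr (_ +i* _); apply: eq_Rintegral => t _; rewrite ?Re_expiM ?Im_expiM.
Qed.

Lemma PsiE (f : R -> R[i]) s : Psi f s =
  high_part (fun t => complex.Re (f t)) (fun t => complex.Im (f t)) s +i*
  high_part (fun t => complex.Im (f t)) (fun t => - complex.Re (f t)) s.
Proof.
congr (_ +i* _); apply: eq_Rintegral => t _.
  by rewrite Re_divr Re_expiM.
by rewrite Im_divr Im_expiM.
Qed.

(** Allows [f] to be exchanged for [truncate f], on which the essential bound holds at every
    point. *)
Lemma transforms_ae_eq (f g : R -> R[i]) : cmeasurable f -> cmeasurable g ->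
  {ae mu, forall t, f t = g t} -> fhat1 f = fhat1 g /\ Psi f = Psi g.
Proof.
move=> [mfR mfI] [mgR mgI] fg.
have mN (u : R -> R) : measurable_fun setT u -> measurable_fun setT (fun t => - u t).
  by move=> mu_; exact: measurableT_comp.
have ae (F : R[i] -> R -> R) : {ae mu, forall t, F (f t) t = F (g t) t}.
  case: fg => N [mN' N0 sub]; exists N; split => // t /= tN.
  by apply: sub => /= ftg; apply: tN; rewrite ftg.
split; apply/funext => s.
- rewrite !fhat1E; congr (_ +i* _); apply: Rintegral_ae_eq.
  + exact: measurable_itv.
  + exact: measurable_low_kernel2.
  + exact: measurable_low_kernel2.
  + exact: (ae (fun z t => cos (s * t) * complex.Re z + sin (s * t) * complex.Im z)).
  + exact: measurable_itv.
  + by apply: measurable_low_kernel2 => //; exact: mN.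
  + by apply: measurable_low_kernel2 => //; exact: mN.
  + exact: (ae (fun z t => cos (s * t) * complex.Im z + sin (s * t) * - complex.Re z)).
- rewrite !PsiE; congr (_ +i* _); apply: Rintegral_ae_eq.
  + exact: measurable_outside.
  + exact: measurable_high_kernel.
  + exact: measurable_high_kernel.
  + exact: (ae (fun z t => (cos (s * t) * complex.Re z + sin (s * t) * complex.Im z) / t ^+ 2)).
  + exact: measurable_outside.
  + by apply: measurable_high_kernel => //; exact: mN.
  + by apply: measurable_high_kernel => //; exact: mN.
  + exact: (ae (fun z t => (cos (s * t) * complex.Im z + sin (s * t) * - complex.Re z) / t ^+ 2)).
Qed.
End Transform.

(** * The second primitive: distributional identity, continuity, modulus of continuity *)

Section Primitive.
Context {R : realType}.
Notation mu := (@lebesgue_measure R).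

Lemma integrable_linear (A B : R -> R) (c : R) :
  mu.-integrable setT (EFin \o A) -> mu.-integrable setT (EFin \o B) ->
  mu.-integrable setT (EFin \o (fun x => A x + c * B x)) /\
  \int[mu]_x (A x + c * B x) = \int[mu]_x A x + c * \int[mu]_x B x.
Proof.
move=> iA iB.
have icB : mu.-integrable setT (EFin \o (fun x => c * B x)).
  rewrite (_ : EFin \o _ = (fun t => c%:E * (EFin \o B) t)%E); first exact: integrableZl.
  by apply/funext => t; rewrite /= EFinM.
split; last by rewrite RintegralD// RintegralZl.
rewrite (_ : EFin \o _ = ((EFin \o A) \+ (EFin \o (fun x => (c * B x)%R)))%E).
  exact: integrableD.
by apply/funext => t; rewrite /= EFinD.
Qed.

(** The bookkeeping for the distributional identity: [c = -1] gives its real part and [c = 1] its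
    imaginary part. [A] and [B] stand for low-part terms, [A'] and [B'] for the same terms after
    integration by parts, [C] and [D] for high-part terms. *)
Lemma integral_combine (A B C D A' B' : R -> R) (c : R) :
  mu.-integrable setT (EFin \o A) -> mu.-integrable setT (EFin \o B) ->
  mu.-integrable setT (EFin \o C) -> mu.-integrable setT (EFin \o D) ->
  mu.-integrable setT (EFin \o A') -> mu.-integrable setT (EFin \o B') ->
  \int[mu]_x A x = \int[mu]_x A' x -> \int[mu]_x B x = \int[mu]_x B' x ->
  mu.-integrable setT (EFin \o (fun x => (A x - C x) + c * (B x - D x))) /\
  \int[mu]_x (A' x + c * B' x) - \int[mu]_x (C x + c * D x) =
  \int[mu]_x ((A x - C x) + c * (B x - D x)).
Proof.
move=> iA iB iC iD iA' iB' AA' BB'.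
have [iAB eAB] := integrable_linear c iA iB.
have [iCD eCD] := integrable_linear c iC iD.
have [iA'B' eA'B'] := integrable_linear c iA' iB'.
have [iABCD eABCD] := integrable_linear (-1) iAB iCD.
have E : (fun x => (A x - C x) + c * (B x - D x)) =
    (fun x => (A x + c * B x) + -1 * (C x + c * D x)).
  by apply/funext => x; ring.
by rewrite E; split => //; rewrite eABCD eAB eA'B' AA' BB'; ring.
Qed.

Lemma cintegralE (D : set R) (F : R -> R[i]) (A B : R -> R) :
  (forall t, complex.Re (F t) = A t) -> (forall t, complex.Im (F t) = B t) ->
  cintegral D F = \int[mu]_(t in D) A t +i* \int[mu]_(t in D) B t.
Proof. by move=> /funext <- /funext <-. Qed.

Lemma cintegrableE (D : set R) (F : R -> R[i]) (A B : R -> R) :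
  (forall t, complex.Re (F t) = A t) -> (forall t, complex.Im (F t) = B t) ->
  mu.-integrable D (EFin \o A) -> mu.-integrable D (EFin \o B) ->
  cintegrable D F.
Proof. by move=> /funext <- /funext <-. Qed.

Lemma subC (x y x' y' : R) : (x +i* y) - (x' +i* y') = (x - x') +i* (y - y').
Proof. by []. Qed.

Lemma Re_mulC (x y : R) (z : R[i]) :
  complex.Re ((x +i* y) * z) = x * complex.Re z + -1 * (y * complex.Im z).
Proof. by rewrite ReM mulN1r. Qed.

Lemma Im_mulC (x y : R) (z : R[i]) :
  complex.Im ((x +i* y) * z) = x * complex.Im z + 1 * (y * complex.Re z).
Proof. by rewrite ImM mul1r. Qed.

Lemma Re_subC_mulC (l0 l1 h0 h1 : R) (z : R[i]) :
  complex.Re (((l0 +i* l1) - (h0 +i* h1)) * z) =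
  (l0 * complex.Re z - h0 * complex.Re z) + -1 * (l1 * complex.Im z - h1 * complex.Im z).
Proof. by rewrite Re_mulC !mulrBl. Qed.

Lemma Im_subC_mulC (l0 l1 h0 h1 : R) (z : R[i]) :
  complex.Im (((l0 +i* l1) - (h0 +i* h1)) * z) =
  (l0 * complex.Im z - h0 * complex.Im z) + 1 * (l1 * complex.Re z - h1 * complex.Re z).
Proof. by rewrite Im_mulC !mulrBl. Qed.

Context (g : R -> R[i]) (M : R).
Context (mg : cmeasurable g) (gM : forall t, Normc.normc (g t) <= M) (g0 : g 0 = 0).

Let a t := complex.Re (g t).
Let b t := complex.Im (g t).
Let na t := - complex.Re (g t).

Definition second_primitive s : R[i] :=
  (low_part a b s +i* low_part b na s) - Psi g s.

Let ma : measurable_fun setT a. Proof. exact: mg.1. Qed.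
Let mb : measurable_fun setT b. Proof. exact: mg.2. Qed.
Let mna : measurable_fun setT na. Proof. exact: (measurableT_comp _ mg.1). Qed.
Let aM t : `|a t| <= M. Proof. exact: le_trans (normc_ge_Re _) (gM t). Qed.
Let bM t : `|b t| <= M. Proof. exact: le_trans (normc_ge_Im _) (gM t). Qed.
Let naM t : `|na t| <= M. Proof. by rewrite normrN; exact: aM. Qed.
Let a0 : a 0 = 0. Proof. by rewrite /a g0. Qed.
Let b0 : b 0 = 0. Proof. by rewrite /b g0. Qed.
Let M0 : 0 <= M. Proof. exact: le_trans (aM 0). Qed.

Lemma low_part_transfer (u w p : R -> R) :
  measurable_fun setT u -> measurable_fun setT w ->
  (forall t, `|u t| <= M) -> (forall t, `|w t| <= M) -> u 0 = 0 ->
  real_schwartz p ->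
  [/\ mu.-integrable setT (EFin \o (fun x => low_part u w x * derive1n 2 p x)),
      mu.-integrable setT (EFin \o (fun x => low_part2 u w x * p x))
    & \int[mu]_x (low_part u w x * derive1n 2 p x) =
      \int[mu]_x (low_part2 u w x * p x)].
Proof.
move=> mu' mw uM wM u0 sp.
have d1 := is_derive_low_part mu' mw uM wM.
have d2 := is_derive_low_part1 mu' mw uM wM u0.
have sq (x : R) : `|x| <= (1 + `|x|) ^+ 2 /\ `|x| ^+ 2 <= (1 + `|x|) ^+ 2 /\ 1 <= (1 + `|x|) ^+ 2.
  by have := normr_ge0 x; split; [nra|split; nra].
have M4 : 0 <= 4 * M by rewrite mulr_ge0.
have B0 x : `|low_part u w x| <= 4 * M * (1 + `|x|) ^+ 2.
  by rewrite (le_trans (low_part_growth mu' mw uM wM u0 _))// ler_wpM2l//; case: (sq x) => _ [].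
have B1 x : `|low_part1 u w x| <= 4 * M * (1 + `|x|) ^+ 2.
  by rewrite (le_trans (low_part1_growth mu' mw uM wM u0 _))// ler_wpM2l//; case: (sq x).
have B2 x : `|low_part2 u w x| <= 4 * M * (1 + `|x|) ^+ 2.
  by rewrite (le_trans (low_part2_le mu' mw uM wM _))// ler_peMr//; case: (sq x) => _ [].
have c2 := continuous_low_part2 mu' mw uM wM.
have c0 : continuous (low_part u w).
  by move=> x; apply: differentiable_continuous; apply/derivable1_diffP; have [] := d1 x.
split.
- exact: (real_schwartz_integrable 2 sp (continuous_measurable_fun c0) B0).
- exact: (real_schwartz_integrable 0 sp (continuous_measurable_fun c2) B2).
- exact: (integration_by_parts_schwartz d1 d2 c2 B0 B1 B2 sp).
Qed.

Lemma high_part_schwartz_integrable (u w p : R -> R) n :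
  measurable_fun setT u -> measurable_fun setT w ->
  (forall t, `|u t| <= M) -> (forall t, `|w t| <= M) -> real_schwartz p ->
  mu.-integrable setT (EFin \o (fun x => high_part u w x * derive1n n p x)).
Proof.
move=> mu' mw uM wM sp.
apply: (real_schwartz_integrable (k := 0) (c := 16 * M) n sp).
  by apply: continuous_measurable_fun; exact: (continuous_high_part mu' mw uM wM).
move=> x; rewrite expr0 mulr1.
by have [] := high_part_integrable_le mu' mw uM wM x.
Qed.

Lemma second_primitive_distr : is_second_distr_derivative second_primitive (fourier g).
Proof.
move=> phi sphi; have [sp sq] := schwartz_real_schwartz sphi.
set p := fun x => complex.Re (phi x); set q := fun x => complex.Im (phi x).
have [iA1 iA1' eA1] := low_part_transfer ma mb aM bM a0 sp.
have [iA2 iA2' eA2] := low_part_transfer ma mb aM bM a0 sq.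
have [iB1 iB1' eB1] := low_part_transfer mb mna bM naM b0 sp.
have [iB2 iB2' eB2] := low_part_transfer mb mna bM naM b0 sq.
have iC1 := high_part_schwartz_integrable 2 ma mb aM bM sp.
have iC2 := high_part_schwartz_integrable 2 ma mb aM bM sq.
have iD1 := high_part_schwartz_integrable 2 mb mna bM naM sp.
have iD2 := high_part_schwartz_integrable 2 mb mna bM naM sq.
have [iR eR] := integral_combine (-1) iA1 iB2 iC1 iD2 iA1' iB2' eA1 eB2.
have [iI eI] := integral_combine 1 iA2 iB1 iC2 iD1 iA2' iB1' eA2 eB1.
have ER s : complex.Re (second_primitive s * cderiven 2 phi s) =
  (low_part a b s * derive1n 2 p s - high_part a b s * derive1n 2 p s)
     + -1 * (low_part b na s * derive1n 2 q s - high_part b na s * derive1n 2 q s).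
  by rewrite /second_primitive PsiE Re_subC_mulC.
have EI s : complex.Im (second_primitive s * cderiven 2 phi s) =
  (low_part a b s * derive1n 2 q s - high_part a b s * derive1n 2 q s)
     + 1 * (low_part b na s * derive1n 2 p s - high_part b na s * derive1n 2 p s).
  by rewrite /second_primitive PsiE Im_subC_mulC.
have LR s : complex.Re (fhat1 g s * phi s) =
    low_part2 a b s * p s + -1 * (low_part2 b na s * q s).
  by rewrite fhat1E Re_mulC.
have LI s : complex.Im (fhat1 g s * phi s) =
    low_part2 a b s * q s + 1 * (low_part2 b na s * p s).
  by rewrite fhat1E Im_mulC.
have HR s : complex.Re (Psi g s * cderiven 2 phi s) =
    high_part a b s * derive1n 2 p s + -1 * (high_part b na s * derive1n 2 q s).
  by rewrite PsiE Re_mulC.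
have HI s : complex.Im (Psi g s * cderiven 2 phi s) =
    high_part a b s * derive1n 2 q s + 1 * (high_part b na s * derive1n 2 p s).
  by rewrite PsiE Im_mulC.
split; first exact: (cintegrableE ER EI iR iI).
have E1 := cintegralE setT ER EI.
have E2 := cintegralE setT LR LI.
have E3 := cintegralE setT HR HI.
rewrite /fourier E1; apply: etrans (congr2 (fun z w => z - w) E2 E3) _.
by apply: etrans (subC _ _ _ _) (congr2 (fun x y => x +i* y) eR eI).
Qed.

Lemma continuous_second_primitive : continuous (second_primitive : R -> R[i]^o).
Proof.
have cl (u w : R -> R) : measurable_fun setT u -> measurable_fun setT w ->
  (forall t, `|u t| <= M) -> (forall t, `|w t| <= M) ->
  continuous (fun s => low_part u w s - high_part u w s).
  move=> mu' mw uM wM s; apply: cvgB; last exact: (continuous_high_part mu' mw uM wM).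
  apply: differentiable_continuous; apply/derivable1_diffP.
  by have [] := is_derive_low_part mu' mw uM wM s.
apply: continuous_complex.
- rewrite (_ : (fun s => _) = (fun s => low_part a b s - high_part a b s)); first exact: cl.
  by apply/funext => s; rewrite /second_primitive ReB PsiE.
- rewrite (_ : (fun s => _) = (fun s => low_part b na s - high_part b na s)); first exact: cl.
  by apply/funext => s; rewrite /second_primitive ImB PsiE.
Qed.

(** The low part yields [ln (|s| + 3)], but [ln (|s| + 1)] vanishes at [s = 0]. The gap is at most
    [ln 3 <= 2], and [|h| <= 1 / e] means [1 <= |ln |h||], so the logarithm of [h] pays for it. *)
Lemma second_primitive_modulus s h : 0 < `|h| <= (expR 1)^-1 ->
  Normc.normc (second_primitive (s + h) - second_primitive s) <=
  400 * M * `|h| * (`|ln `|h| | + ln (`|s| + 1)).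
Proof.
move=> hh; have /andP[h0 he] := hh.
have h2 : `|h| <= 2^-1 by rewrite (le_trans he)// expR1_inv_le_half.
have h1 : `|h| <= 1 by lra.
have lh : 1 <= `|ln `|h| |.
  rewrite ler0_norm ?ln_le0// lerNr -[leRHS]expRK expRN.
  by rewrite ler_ln ?posrE// invr_gt0 expR_gt0.
have ls0 : 0 <= ln (`|s| + 1) by rewrite ln_ge0// lerDr.
have ls : ln (`|s| + 3) <= 2 * `|ln `|h| | + ln (`|s| + 1).
  have -> : ln (`|s| + 3) <= 2 * `|ln `|h| | + ln (`|s| + 1) = (ln (`|s| + 3) - ln (`|s| + 1) <= 2 * `|ln `|h| |).
    by rewrite lerBlDr.
  rewrite -ln_div ?posrE ?ltr_wpDl//.
  apply: (@le_trans _ _ 2); last by lra.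
  rewrite -[leRHS]expRK ler_ln ?posrE ?expR_gt0 ?divr_gt0 ?ltr_wpDl//.
  apply: (@le_trans _ _ 3); last by have := expR_ge1Dx (2 : R); lra.
  by rewrite ler_pdivrMr ?ltr_wpDl//; have := normr_ge0 s; lra.
(* The coefficient of [|ln |h||] is 48 * 2 from the low part plus 48 from the high part, below 200;
   adding real and imaginary parts gives 400. *)
have comp (u w : R -> R) : measurable_fun setT u -> measurable_fun setT w ->
    (forall t, `|u t| <= M) -> (forall t, `|w t| <= M) ->
    `|(low_part u w (s + h) - high_part u w (s + h)) - (low_part u w s - high_part u w s)|
    <= 200 * M * `|h| * (`|ln `|h| | + ln (`|s| + 1)).
  move=> mu' mw uM wM.
  have H1 := low_part_modulus mu' mw uM wM s h1.
  have H2 := high_part_modulus mu' mw uM wM s hh.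
  have -> : (low_part u w (s + h) - high_part u w (s + h)) - (low_part u w s - high_part u w s) =
    (low_part u w (s + h) - low_part u w s) - (high_part u w (s + h) - high_part u w s) by ring.
  apply: (le_trans (ler_normB _ _)); apply: (le_trans (lerD H1 H2)).
  have Mh : 0 <= M * `|h| by rewrite mulr_ge0.
  have H3 := ler_wpM2l Mh ls.
  have H4 : 0 <= M * `|h| * `|ln `|h| | by rewrite mulr_ge0.
  have H5 : 0 <= M * `|h| * ln (`|s| + 1) by rewrite mulr_ge0.
  lra.
apply: (le_trans (normc_le_ReIm _)).
rewrite ReB ImB /second_primitive !ReB !ImB !PsiE /=.
have -> : 400 * M * `|h| * (`|ln `|h| | + ln (`|s| + 1)) =
  200 * M * `|h| * (`|ln `|h| | + ln (`|s| + 1)) + 200 * M * `|h| * (`|ln `|h| | + ln (`|s| + 1)) by ring.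
by apply: lerD; apply: comp.
Qed.
End Primitive.

Lemma second_primitive_exists (R : realType) (f : R -> R[i]) : Linfty f ->
  exists Phi : R -> R[i],
    [/\ continuous (Phi : R -> R[i]^o),
        is_second_distr_derivative Phi (fourier f)
      & forall s h : R, 0 < `|h| <= (expR 1)^-1 ->
          Normc.normc (Phi (s + h) - Phi s)
            <= 400 * Linfty_norm f * `|h| * (`|ln `|h| | + ln (`|s| + 1))].
Proof.
move=> Lf; have [mg gM g0 fg] := truncateP Lf.
exists (second_primitive (truncate f)); split.
- exact: continuous_second_primitive mg gM.
- have [E1 E2] := transforms_ae_eq Lf.1 mg fg.
  by rewrite /fourier E1 E2; exact: second_primitive_distr mg gM g0.
- exact: second_primitive_modulus mg gM.
Qed.

(** * Logistic test functions *)

Section Logistic.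
Context {R : realType}.
Notation mu := (@lebesgue_measure R).
Implicit Types (l x : R).

(** A smooth step with explicit derivatives: from [sigma' = l sigma (1 - sigma)], each derivative is
    a polynomial in [sigma], and the factor [sigma (1 - sigma)] decays exponentially. *)
Definition logistic l x : R := (1 + expR (- (l * x)))^-1.

Lemma is_derive_logistic l x :
  is_derive x 1 (logistic l) (l * (logistic l x * (1 - logistic l x))).
Proof.
have d1 : is_derive x 1 (fun x : R => - (l * x)) (- l).
  by apply: is_derive_eq; rewrite /GRing.scale/=; ring.
have d2 := is_derive1_comp (is_derive_expR _) d1.
have n0 : 1 + expR (- (l * x)) != 0 by rewrite gt_eqF// ltr_wpDl ?expR_gt0.
have d3 : is_derive x 1 (fun x => 1 + expR (- (l * x))) (expR (- (l * x)) * - l).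
  have := is_deriveD (is_derive_cst (1 : R) x 1) d2.
  by rewrite add0r.
have d4 := @is_deriveV _ (fun x => 1 + expR (- (l * x))) x _ 1 n0 d3.
apply: (is_derive_eq d4); rewrite /logistic /GRing.scale/=.
by move: (expR _) n0 => E n0; field.
Qed.

Fixpoint logistic_poly l n : {poly R} :=
  if n is n'.+1 then (logistic_poly l n')^`() * (l *: ('X * (1 - 'X))) else 'X.

Lemma derive1n_logistic l n :
  derive1n n (logistic l) = (fun x => (logistic_poly l n).[logistic l x]).
Proof.
elim: n => [|n IH]; first by apply/funext => x; rewrite /= hornerX.
rewrite derive1nS IH; apply/funext => x; rewrite derive1E.
have d := is_derive1_comp (is_derive_poly (logistic_poly l n) (logistic l x)) (is_derive_logistic l x).
have [_ ->] := d.
by rewrite /= !hornerE; ring.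
Qed.

Lemma derivable_derive1n_logistic l n x : derivable (derive1n n (logistic l)) x 1.
Proof.
rewrite derive1n_logistic.
by have [] := is_derive1_comp (is_derive_poly (logistic_poly l n) (logistic l x)) (is_derive_logistic l x).
Qed.

Lemma logistic_gt0 l x : 0 < logistic l x.
Proof. by rewrite invr_gt0 ltr_wpDr// expR_ge0. Qed.

Lemma logistic_lt1 l x : logistic l x < 1.
Proof. by rewrite invf_lt1 ?ltrDl ?expR_gt0// ltr_wpDr// expR_ge0. Qed.

Lemma logistic_le l x : logistic l x <= expR (l * x).
Proof.
rewrite -[l * x]opprK expRN lef_pV2 ?posrE ?expR_gt0 ?ltr_wpDr ?expR_ge0//.
by rewrite lerDr.
Qed.

Lemma oneBlogistic_le l x : 1 - logistic l x <= expR (- (l * x)).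
Proof.
rewrite /logistic; have := expR_gt0 (- (l * x)); move: (expR _) => E E0.
have -> : 1 - (1 + E)^-1 = E / (1 + E) by field; apply/eqP; lra.
by rewrite ler_pdivrMr; nra.
Qed.

(** Both factors lie below 1, and on each half-line one of them is exponentially small. *)
Lemma logistic_product_le l x : 0 <= l ->
  logistic l x * (1 - logistic l x) <= expR (- (l * `|x|)).
Proof.
move=> l0; have g0 := logistic_gt0 l x; have l1 := logistic_lt1 l x.
have [x0|x0] := ger0P x.
  by have := oneBlogistic_le l x; nra.
by have := logistic_le l x; rewrite mulrN opprK; nra.
Qed.

Lemma horner_bounded_itv01 (q : {poly R}) :
  exists2 C, 0 <= C & forall x, 0 <= x <= 1 -> `|q.[x]| <= C.
Proof.
elim/poly_ind: q => [|q c [C C0 IH]].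
  by exists 0 => // x _; rewrite horner0 normr0.
exists (C + `|c|); first by rewrite addr_ge0.
move=> x x01; rewrite hornerMXaddC (le_trans (ler_normD _ _))// lerD//.
rewrite normrM -[C]mulr1 ler_pM ?IH//.
by move/andP: x01 => [x0 x1]; rewrite ger0_norm.
Qed.

(** The [k]-th power of [1 + y <= k (1 + y / k) <= k exp(y / k)]; for [k = 0] the convention
    [0 ^+ 0 = 1] is used. *)
Lemma exprn_le_expR (k : nat) (y : R) : 0 <= y ->
  (1 + y) ^+ k <= k%:R ^+ k * expR y.
Proof.
move=> y0; case: k => [|k].
  by rewrite !expr0 mul1r; have := expR_ge1Dx y; lra.
have k0 : (0 : R) < k.+1%:R by rewrite ltr0n.
have k1 : (1 : R) <= k.+1%:R by rewrite ler1n.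
have -> : y = k.+1%:R * (y / k.+1%:R) by field; rewrite nat1r.
rewrite expRM_natl -exprMn lerXn2r ?nnegrE//.
  by rewrite addr_ge0// mulr_ge0// divr_ge0// ltW.
set z := y / _; have z0 : 0 <= z by rewrite divr_ge0// ltW.
by have := expR_ge1Dx z; nra.
Qed.

Lemma exprn_mul_expRN_le (k : nat) (l x : R) : 1 <= l ->
  (1 + `|x|) ^+ k * expR (- (l * `|x|)) <= k%:R ^+ k.
Proof.
move=> l1; rewrite expRN ler_pdivrMr ?expR_gt0//.
apply: (le_trans (exprn_le_expR k (normr_ge0 x))).
by rewrite ler_wpM2l ?exprn_ge0// ler_expR ler_peMl.
Qed.

(** From order 1 on, the recursion exhibits the factor [sigma (1 - sigma)]; the remaining polynomial
    is bounded because [sigma] stays in [[0, 1]]. Order 0 is left out since [sigma] tends to 1. *)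
Lemma derive1n_logistic_decay l n k : 1 <= l ->
  exists C, forall x, (1 + `|x|) ^+ k * `|derive1n n.+1 (logistic l) x| <= C.
Proof.
move=> l1; have l0 : 0 <= l by lra.
have [C C0 HC] := horner_bounded_itv01 (l *: (logistic_poly l n)^`()).
exists (C * k%:R ^+ k) => x.
have g0 := logistic_gt0 l x; have g1 := logistic_lt1 l x.
have -> : derive1n n.+1 (logistic l) x = (l *: (logistic_poly l n)^`()).[logistic l x] *
    (logistic l x * (1 - logistic l x)).
  by rewrite derive1n_logistic [logistic_poly _ _]/= !hornerE /=; ring.
rewrite normrM mulrCA; apply: ler_pM => //.
- by apply: HC; rewrite !ltW.
- apply: le_trans (exprn_mul_expRN_le k x l1).
  rewrite ler_wpM2l ?exprn_ge0 ?addr_ge0// ger0_norm; last first.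
    by rewrite mulr_ge0 ?subr_ge0 ?ltW.
  exact: logistic_product_le.
Qed.

(** Both functions have the same limits at each end, and for [l >= 1] the one with parameter 1
    approaches them more slowly. *)
Lemma logisticB_le l x : 1 <= l ->
  `|logistic l x - logistic 1 x| <= expR (- (1 * `|x|)).
Proof.
move=> l1; have [x0|x0] := ger0P x.
- have e1 : expR (- (l * x)) <= expR (- (1 * x)) by rewrite ler_expR; nra.
  have := oneBlogistic_le l x; have := oneBlogistic_le 1 x.
  have := logistic_lt1 l x; have := logistic_lt1 1 x.
  by rewrite ler_norml => *; apply/andP; split; lra.
- have e1 : expR (l * x) <= expR (1 * x) by rewrite ler_expR; nra.
  have := logistic_le l x; have := logistic_le 1 x.
  have := logistic_gt0 l x; have := logistic_gt0 1 x.
  by rewrite mulrN opprK ler_norml => *; apply/andP; split; lra.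
Qed.

Definition logistic_step l x := logistic l x - logistic 1 x.

Lemma derive1n_logistic_step l n : derive1n n (logistic_step l) =
  (fun x => derive1n n (logistic l) x - derive1n n (logistic 1) x).
Proof.
elim: n => [//|n IH]; rewrite !derive1nS IH; apply/funext => x.
by rewrite !derive1E deriveB//; exact: derivable_derive1n_logistic.
Qed.

Lemma real_schwartz_logistic_step l : 1 <= l -> real_schwartz (logistic_step l).
Proof.
move=> l1; split => [n x|k n].
  rewrite derive1n_logistic_step; apply: derivableB; exact: derivable_derive1n_logistic.
case: n => [|n].
  exists (k%:R ^+ k) => x; apply: le_trans (exprn_mul_expRN_le k x (lexx 1)).
  by rewrite ler_wpM2l ?exprn_ge0 ?addr_ge0//; exact: logisticB_le.
have [C1 H1] := derive1n_logistic_decay n k l1.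
have [C2 H2] := derive1n_logistic_decay n k (lexx 1).
exists (C1 + C2) => x; rewrite derive1n_logistic_step.
apply: (le_trans _ (lerD (H1 x) (H2 x))).
by rewrite -mulrDr ler_wpM2l ?exprn_ge0 ?addr_ge0// ler_normB.
Qed.

Lemma derive1n_cst0 n : derive1n n (fun=> 0 : R) = (fun=> 0).
Proof.
elim: n => [//|n IH]; rewrite derive1nS IH; apply/funext => x.
exact: derive1_cst.
Qed.

Lemma schwartz_logistic_step l : 1 <= l ->
  schwartz (fun x => (logistic_step l x)%:C).
Proof.
move=> l1; have [dp bp] := real_schwartz_logistic_step l1.
split => [n x|m n].
  split; first exact: dp.
  by rewrite /= derive1n_cst0; exact: derivable_cst.
have [C HC] := bp m n; exists C => x.
apply: le_trans (HC x).
rewrite ler_pM ?exprn_ge0//.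
- by rewrite /cderiven /= sqrtr_ge0.
- by rewrite lerXn2r ?nnegrE ?addr_ge0// lerDr.
- by rewrite /cderiven /= derive1n_cst0 expr0n addr0 sqrtr_sqr.
Qed.
End Logistic.

(** * The second derivative of the logistic function *)

Section LogisticCurvature.
Context {R : realType}.
Notation mu := (@lebesgue_measure R).
Implicit Types (l x : R).

Lemma logistic_product_ge0 l x : 0 <= logistic l x * (1 - logistic l x).
Proof.
have g0 := logistic_gt0 l x; have g1 := logistic_lt1 l x.
by apply: mulr_ge0; [exact: ltW|rewrite subr_ge0 ltW].
Qed.

Definition curvature l x : R := derive1n 2 (logistic l) x.

Lemma curvatureE l x : curvature l x =
  l ^+ 2 * (logistic l x * (1 - logistic l x)) * (1 - 2 * logistic l x).
Proof.
rewrite /curvature derive1n_logistic /= derivX mul1r derivZ derivM -polyC1 derivB derivC derivX.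
by rewrite !hornerE /=; ring.
Qed.

(** With [y = l |x|], [y (1 + y)^2 <= (1 + y)^3 <= 27 exp(y)], and [exp(y)] is cancelled by the
    decay of [sigma (1 - sigma)]. The majorant has integral 54 whatever [l] is, which is the
    uniformity that the Lipschitz case requires. *)
Lemma norm_mul_curvature_le l x : 1 <= l ->
  `|x * curvature l x| <= 27 * sqr_majorant l x.
Proof.
move=> l1; have l0 : 0 <= l by lra.
have g0 := logistic_gt0 l x; have g1 := logistic_lt1 l x.
have P := logistic_product_le x l0.
have y0 : 0 <= l * `|x| by rewrite mulr_ge0.
have E := exprn_le_expR 3 y0.
rewrite curvatureE /sqr_majorant [leRHS]mulrA ler_pdivlMr ?exprn_gt0 ?ltr_wpDr//.
rewrite !normrM (ger0_norm l0).
rewrite (ger0_norm (ltW g0)) [`|1 - logistic l x|]ger0_norm; last by rewrite subr_ge0 ltW.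
have h : `|1 - 2 * logistic l x| <= 1 by rewrite ler_norml; lra.
move: P; rewrite expRN => P.
have e0 := expR_gt0 (l * `|x|).
set y := l * `|x| in y0 E P e0 *.
have P' : logistic l x * (1 - logistic l x) * expR y <= 1.
  by rewrite -ler_pdivlMr// mul1r.
have q0 := logistic_product_ge0 l x.
set q := logistic l x * (1 - logistic l x) in q0 P P' *.
have -> : `|x| * (l * l * q * `|1 - 2 * logistic l x|) * (1 + y) ^+ 2 =
   l * (y * (1 + y) ^+ 2 * q) * `|1 - 2 * logistic l x| by rewrite /y; ring.
have H : y * (1 + y) ^+ 2 * q <= 27.
  apply: (@le_trans _ _ ((1 + y) ^+ 3 * q)); first by rewrite ler_wpM2r//; nra.
  apply: (@le_trans _ _ (3%:R ^+ 3 * expR y * q)); first by rewrite ler_wpM2r.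
  by nra.
have H0 : 0 <= y * (1 + y) ^+ 2 * q by rewrite mulr_ge0// mulr_ge0// exprn_ge0// addr_ge0.
rewrite [27 * l]mulrC -[leRHS]mulr1; apply: ler_pM => //; first exact: mulr_ge0.
by rewrite ler_wpM2l.
Qed.

(** The step is convex before 0 and concave after it. The sign lets lower bounds on
    [x * sine_transform x] survive multiplication by the curvature. *)
Lemma mul_curvature_le0 l x : 0 <= l -> x * curvature l x <= 0.
Proof.
move=> l0; rewrite curvatureE.
have g0 := logistic_gt0 l x; have g1 := logistic_lt1 l x.
have q0 : 0 <= l ^+ 2 * (logistic l x * (1 - logistic l x)).
  by rewrite mulr_ge0 ?sqr_ge0// logistic_product_ge0.
have [x0|x0] := leP 0 x.
- have : 1 - 2 * logistic l x <= 0.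
    have : 2^-1 <= logistic l x.
      rewrite lef_pV2 ?posrE ?ltr_wpDr ?expR_ge0//.
      have : expR (- (l * x)) <= 1 by rewrite -expR0 ler_expR; nra.
      lra.
    lra.
  by move=> h; rewrite mulr_ge0_le0// mulr_ge0_le0.
- have : 0 <= 1 - 2 * logistic l x.
    have : logistic l x <= 2^-1.
      rewrite lef_pV2 ?posrE ?ltr_wpDr ?expR_ge0//.
      have : 1 <= expR (- (l * x)) by rewrite -expR0 ler_expR; nra.
      lra.
    lra.
  by move=> h; apply: mulr_le0_ge0; [exact: ltW|exact: mulr_ge0].
Qed.

(** By scaling, [- (x * curvature l x)] is [l] times a function of [l x] alone, which is positive
    and bounded below on [[1/2, 1]]. *)
Lemma curvature_concentration : exists2 d : R, 0 < d &
  forall l x, 0 < l -> 2^-1 <= l * x <= 1 -> l * d <= - (x * curvature l x).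
Proof.
pose E1 : R := expR (- 1); pose E2 : R := expR (- 2^-1).
have E10 : 0 < E1 := expR_gt0 _.
have E21 : E2 < 1 by rewrite -expR0 ltr_expR; lra.
(* With [E = exp(- l x)] between [E1] and [E2], the factor other than [l x >= 1/2] is
   [E (1 - E) / (1 + E)^3], and [1 + E <= 2]. *)
exists (2^-1 * (E1 * (1 - E2) / 8)).
  by rewrite mulr_gt0// divr_gt0// mulr_gt0// subr_gt0.
move=> l x l0 /andP[y1 y2].
have -> : - (x * curvature l x) = l * ((l * x) * (logistic l x * (1 - logistic l x) * (2 * logistic l x - 1))).
  by rewrite curvatureE; ring.
apply: (ler_wpM2l (ltW l0)); apply: ler_pM => //.
  by apply: divr_ge0 => //; apply: mulr_ge0; [exact: ltW|rewrite subr_ge0 ltW].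
rewrite /logistic.
have e1 : E1 <= expR (- (l * x)) by rewrite ler_expR lerN2.
have e2 : expR (- (l * x)) <= E2 by rewrite ler_expR lerN2.
move: (expR (- (l * x))) e1 e2 => E e1 e2.
have n0 : 1 + E != 0 by apply/eqP; lra.
have -> : (1 + E)^-1 * (1 - (1 + E)^-1) * (2 * (1 + E)^-1 - 1) = E * (1 - E) / (1 + E) ^+ 3.
  by field.
have a0 : 0 <= E1 * (1 - E2) by apply: mulr_ge0; lra.
have a1 : E1 * (1 - E2) <= E * (1 - E) by apply: ler_pM => //; lra.
have a2 : (8 : R)^-1 <= ((1 + E) ^+ 3)^-1.
  rewrite lef_pV2 ?posrE ?exprn_gt0//; last by lra.
  have -> : 8 = 2 ^+ 3 :> R by rewrite -natrX.
  by rewrite lerXn2r ?nnegrE//; lra.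
exact: ler_pM.
Qed.

Lemma continuous_curvature l : continuous (curvature l).
Proof.
move=> x; have := @derivable_derive1n_logistic R l 2 x.
by move=> /derivable1_diffP/differentiable_continuous.
Qed.

Lemma curvature_decay l : 1 <= l ->
  exists2 C, 0 <= C & forall x, `|curvature l x| * (1 + `|x|) <= C * sqr_majorant 1 x.
Proof.
(* Of the three powers of decay, one is the weight [1 + |x|] and two become [sqr_majorant 1]. *)
move=> l1; have [C HC] := derive1n_logistic_decay 1 3 l1.
exists C; first by apply: le_trans (HC 0); rewrite mulr_ge0// exprn_ge0// addr_ge0.
move=> x; rewrite /sqr_majorant !mul1r ler_pdivlMr ?exprn_gt0 ?ltr_wpDr//.
by apply: le_trans (HC x); rewrite -mulrA -exprS mulrC.
Qed.

Lemma Rintegral_curvature l : 1 <= l -> \int[mu]_x curvature l x = 0.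
Proof.
move=> l1; have [C C0 HC] := curvature_decay l1.
have [C' HC'] := derive1n_logistic_decay 0 1 l1.
have C'0 : 0 <= C' by apply: le_trans (HC' 0); rewrite mulr_ge0// exprn_ge0// addr_ge0.
apply: (@Rintegral_derivative_eq0 R (derive1n 1 (logistic l)) _ (C + C')).
- exact: addr_ge0.
- move=> x; apply: DeriveDef; first exact: (@derivable_derive1n_logistic R l 1 x).
  by rewrite -derive1E /curvature [in RHS]derive1nS.
- exact: continuous_curvature.
- move=> x; apply: (@le_trans _ _ (`|curvature l x| * (1 + `|x|))).
    by rewrite ler_peMr// lerDl.
  apply: (le_trans (HC x)); rewrite ler_wpM2r ?lerDl//.
  by rewrite sqr_majorant_ge0.
- move=> x; rewrite mulrC -[1 + _]expr1; apply: (le_trans (HC' x)).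
  by rewrite lerDr.
Qed.

Lemma integrable_mul_curvature l (u : R -> R) c : 1 <= l ->
  measurable_fun setT u -> 0 <= c -> (forall x, `|u x| <= c * (1 + `|x|)) ->
  mu.-integrable setT (EFin \o (fun x => u x * curvature l x)).
Proof.
move=> l1 mu_ c0 uc; have [C C0 HC] := curvature_decay l1.
have [iL _] := integrable_sqr_majorant (@ltr01 R).
have m : measurable_fun setT (fun x => u x * curvature l x).
  apply: measurable_funM => //.
  by apply: continuous_measurable_fun; exact: continuous_curvature.
have H x : setT x -> `|u x * curvature l x| <= c * C * sqr_majorant 1 x.
  move=> _; rewrite normrM; apply: (@le_trans _ _ (c * (1 + `|x|) * `|curvature l x|)).
    by rewrite ler_wpM2r.
  by rewrite -!mulrA ler_wpM2l// mulrC.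
by have [] := majorized_Rintegral measurableT m iL
  (fun t => sqr_majorant_ge0 _ ler01) (mulr_ge0 c0 C0) H.
Qed.

(* The curvature has integral 0, so [u] may be replaced by [u - u 0], bounded by [L |x|]. *)
Lemma lipschitz_curvature_le l (u : R -> R) L : 1 <= l -> 0 <= L ->
  (forall x y, `|u x - u y| <= L * `|x - y|) -> measurable_fun setT u ->
  `|\int[mu]_x (u x * curvature l x)| <= 54 * L.
Proof.
move=> l1 L0 uL mu_.
have l0 : 0 < l by lra.
have [iL intL] := integrable_sqr_majorant l0.
have mK : measurable_fun setT (curvature l).
  by apply: continuous_measurable_fun; exact: continuous_curvature.
have i1 : mu.-integrable setT (EFin \o (fun x => (u x - u 0) * curvature l x)).
  apply: (integrable_mul_curvature l1 _ L0); first exact: measurable_funB.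
  move=> x; apply: (le_trans (uL x 0)).
  by rewrite subr0 ler_wpM2l// lerDr.
have i2 : mu.-integrable setT (EFin \o curvature l).
  have := @integrable_mul_curvature l (fun=> 1) 1 l1 (measurable_cst _) ler01.
  rewrite (_ : (fun x => 1 * curvature l x) = curvature l); last first.
    by apply/funext => x; rewrite mul1r.
  by apply => x; rewrite normr1 mul1r lerDl.
have [_ e] := integrable_linear (u 0) i1 i2.
have E : (fun x => u x * curvature l x) =
  (fun x => (u x - u 0) * curvature l x + u 0 * curvature l x).
  by apply/funext => x; rewrite -mulrDl subrK.
rewrite E e Rintegral_curvature// mulr0 addr0.
have m1 : measurable_fun setT (fun x => (u x - u 0) * curvature l x).
  by apply: measurable_funM => //; exact: measurable_funB.
have H x : setT x -> `|(u x - u 0) * curvature l x| <= L * 27 * sqr_majorant l x.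
  move=> _; rewrite normrM; apply: (@le_trans _ _ (L * `|x| * `|curvature l x|)).
    by rewrite ler_wpM2r//; have := uL x 0; rewrite subr0.
  by rewrite -!mulrA -normrM ler_wpM2l// norm_mul_curvature_le.
have [_] := majorized_Rintegral measurableT m1 iL
  (fun t => sqr_majorant_ge0 _ (ltW l0)) (mulr_ge0 L0 (ler0n _ 27)) H.
by rewrite intL => /le_trans; apply; lra.
Qed.

End LogisticCurvature.

(** * The indicator of ]1, +oo[ *)

Section Step.
Context {R : realType}.
Notation mu := (@lebesgue_measure R).
Implicit Types (s t x : R).

(** Vanishing on [[-1, 1]], it leaves only the [Psi] term of the transform; being one-sided, it
    gives [Psi] an odd imaginary part. *)
Definition step t : R[i] := if 1 < t then 1 else 0.

Lemma Re_step t : complex.Re (step t) = if 1 < t then 1 else 0.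
Proof. by rewrite /step; case: ifP. Qed.

Lemma Im_step t : complex.Im (step t) = 0.
Proof. by rewrite /step; case: ifP. Qed.

Lemma Linfty_step : Linfty step.
Proof.
split; first split.
- under eq_fun do rewrite Re_step.
  apply: measurable_fun_ifT => //.
  exact: measurable_fun_ltr.
- by under eq_fun do rewrite Im_step; exact: measurable_cst.
rewrite /Linfty_enorm unlock; case: ifP => _; last exact: ltry.
apply: (@le_lt_trans _ _ 1%:E); last exact: ltry.
apply/ess_supP; apply: aeW => t /=.
rewrite lee_fin ger0_norm; last by rewrite /step; case: ifP => _ /=; exact: sqrtr_ge0.
rewrite /step; case: ifP => _ /=; first by rewrite expr1n expr0n addr0 sqrtr1.
by rewrite expr0n addr0 sqrtr0.
Qed.

Lemma fhat1_step s : fhat1 step s = 0.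
Proof.
rewrite fhat1E /low_part2.
have z (F : R -> R) : (forall t, t <= 1 -> F t = 0) -> \int[mu]_(t in `[-1, 1]) F t = 0.
  move=> F0; transitivity (\int[mu]_(t in `[-1, 1]) (0 : R)).
    by apply: eq_Rintegral => t; rewrite inE/= in_itv/= => /andP[_ /F0].
  by rewrite Rintegral_cst ?mul0r//; exact: measurable_itv.
rewrite !z// => t t1; rewrite /low_kernel2 Re_step Im_step ltNge t1/=; ring.
Qed.

Definition sine_transform s := \int[mu]_(t in `[1, +oo[) (sin (s * t) / t ^+ 2).

Lemma sine_transform_integrable s :
  mu.-integrable `[1, +oo[ (EFin \o (fun t => sin (s * t) / t ^+ 2)).
Proof.
have [iL _] := integrable_sqr_majorant (@ltr01 R).
have ms : measurable_fun setT (fun t => sin (s * t) / t ^+ 2).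
  apply: measurable_funM; first exact: measurable_sinM.
  under eq_fun do rewrite -exprVn; apply: measurable_funX; exact: measurable_inv.
have H t : `[1, +oo[%classic t -> `|sin (s * t) / t ^+ 2| <= 4 * sqr_majorant 1 t.
  rewrite /= in_itv/= andbT => t1.
  rewrite /sqr_majorant !mul1r normrM normfV [`|t ^+ 2|]ger0_norm ?sqr_ge0//.
  have t0 : 0 < t by lra.
  rewrite (ger0_norm (ltW t0)) ler_pdivrMr ?exprn_gt0//.
  apply: (le_trans (sin_max _)).
  rewrite mulrAC ler_pdivlMr; last by rewrite exprn_gt0//; lra.
  by rewrite mul1r; nra.
by have [] := majorized_Rintegral (measurable_itv `[1, +oo[) (measurable_funTS ms) iL
  (fun t => sqr_majorant_ge0 _ ler01) (ler0n _ 4) H.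
Qed.

Lemma Im_Psi_step s : complex.Im (Psi step s) = - sine_transform s.
Proof.
rewrite PsiE /= /high_part /sine_transform -mulN1r -RintegralZl; last 2 first.
- exact: measurable_itv.
- exact: sine_transform_integrable.
have iS := sine_transform_integrable s.
(* [step] is 0 at 1 itself, so the closed half-line is exchanged for the open one before comparing
   integrands. *)
rewrite -Rintegral_itv_obnd_cbnd; last first.
  have iN := integrableN iS.
  apply: (@integrableS _ _ _ mu `[1, +oo[) => //.
    by apply: subset_itvr; rewrite bnd_simp.
  rewrite (_ : EFin \o _ = (fun x => - (EFin \o (fun t => (sin (s * t) / t ^+ 2)%R)) x)%E)//.
  by apply/funext => t /=; rewrite mulN1r.
rewrite Rintegral_mkcond [RHS]Rintegral_mkcond; apply: eq_Rintegral => t _.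
rewrite !patchE; have [t1|t1] := ltP 1 t.
  rewrite !mem_set//=; last first.
  - by rewrite (lt_le_trans t1)// ler_norm.
  - by rewrite in_itv/= t1.
  by rewrite /high_kernel Re_step Im_step t1; ring.
rewrite [in RHS]memNset//=; last by rewrite in_itv/= ltNge t1.
by case: ifP => // _; rewrite /high_kernel Re_step Im_step ltNge t1/= oppr0 !mulr0 addr0 mul0r.
Qed.

(** By the mean value theorem, [sin x = x cos c] with [0 < c < 1], and
    [cos c = 1 - 2 sin(c / 2)^2 >= 1/2]. *)
Lemma sin_ge_half x : 0 <= x <= 1 -> x / 2 <= sin x.
Proof.
move=> /andP[x0 x1].
have [->|xn0] := eqVneq x 0; first by rewrite mul0r sin0.
have xp : 0 < x by rewrite lt_def xn0.
have cs : {within `[0, x], continuous (@sin R)}.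
  by apply: continuous_subspaceT => y; exact: continuous_sin.
have [c] := @MVT R sin cos 0 x xp (fun y _ => is_derive_sin y) cs.
rewrite in_itv/= sin0 !subr0 => /andP[c0 cx] ->.
rewrite mulrC ler_wpM2r//.
have := norm_oneBcos_le_sqr (c / 2 * 2).
have := norm_sin_le (c / 2); rewrite [`|c / 2|]ger0_norm; last by lra.
move=> /ler_normlP[_ s1] _.
have : sin (c / 2) ^+ 2 <= (c / 2) ^+ 2.
  have s0 : 0 <= sin (c / 2) by apply/ltW/sin_gt0_pihalf; have := pihalf_ge1 R; lra.
  by rewrite lerXn2r ?nnegrE//; lra.
have -> : cos c = cos ((c / 2) *+ 2) by congr cos; rewrite -mulr_natr; field.
by rewrite cos_mulr2n -mulr_natr cos2sin2; nra.
Qed.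

(* For [s t <= 1] the first term wins because [sin x >= x / 2]; for [s t > 1] the
   second one absorbs [sin x >= -1]. *)
Lemma sine_kernel_ge s t : 0 < s -> 1 <= t ->
  s / 2 * log_majorant s t - 5 * s ^+ 2 * sqr_majorant s t <=
    s * (sin (s * t) / t ^+ 2).
Proof.
move=> s0 t1; have t0 : 0 < t by lra.
have x0 : 0 < s * t by rewrite mulr_gt0.
rewrite /log_majorant /sqr_majorant (ger0_norm (ltW t0)).
have e1 : s / (1 + t) <= s / t by rewrite ler_pM2l// lef_pV2 ?posrE//; lra.
have E : s * (sin (s * t) / t ^+ 2) = s ^+ 3 * (sin (s * t) / (s * t) ^+ 2).
  by field; rewrite !gt_eqF.
have E2 : s / 2 * (s / ((1 + t) * (1 + s * t))) <= s ^+ 3 * (2^-1 / (s * t * (1 + s * t))).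
  have -> : s ^+ 3 * (2^-1 / (s * t * (1 + s * t))) = s / 2 * ((s / t) / (1 + s * t)).
    by field; rewrite !gt_eqF// ltr_wpDl// ltW.
  have -> : s / ((1 + t) * (1 + s * t)) = (s / (1 + t)) / (1 + s * t).
    by rewrite invfM mulrA.
  apply: ler_wpM2l; first by rewrite divr_ge0// ltW.
  by rewrite ler_wpM2r// invr_ge0; lra.
have E3 : 5 * s ^+ 2 * (s / (1 + s * t) ^+ 2) = s ^+ 3 * (5 / (1 + s * t) ^+ 2) by ring.
rewrite E E3; apply: (le_trans (lerB E2 (lexx _))).
rewrite -mulrBr; apply: ler_wpM2l; first by rewrite exprn_ge0// ltW.
(* With [s ^+ 3] factored out, only [x = s t] remains. The 5 is what [sin x >= -1] demands at
   [x = 1]. *)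
move: (s * t) x0 => x x0 {E E2 E3 e1}.
have xn : x != 0 by rewrite gt_eqF.
have x1n : 1 + x != 0 by apply/eqP; lra.
rewrite ler_pdivlMr ?exprn_gt0//.
have -> : (2^-1 / (x * (1 + x)) - 5 / (1 + x) ^+ 2) * x ^+ 2 =
  (x / 2 * (1 + x) - 5 * x ^+ 2) / (1 + x) ^+ 2.
  by field; rewrite xn x1n.
rewrite ler_pdivrMr; last by rewrite exprn_gt0//; lra.
have [x1|x1] := leP x 1.
  have : x / 2 <= sin x by apply: sin_ge_half; rewrite (ltW x0).
  by nra.
have := sin_geN1 x; nra.
Qed.

(** Integrates [sine_kernel_ge]. The 10 is 5 times the total integral 2 of [sqr_majorant s]; the 11
    leaves room for half the loss in [ln ((1 + s) / 2) >= -1]. The first bound controls the error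
    everywhere, the second carries the logarithm. *)
Lemma sine_transform_ge s : 0 < s ->
  - (10 * s ^+ 2) <= s * sine_transform s /\
  (s < 1 -> s ^+ 2 * (- ln s / 2 - 11) <= s * sine_transform s).
Proof.
move=> s0.
have iS := sine_transform_integrable s.
have [iQ intQ] := integrable_sqr_majorant s0.
have mi : measurable (`[(1 : R), +oo[%classic : set R) by exact: measurable_itv.
have iQ1 : mu.-integrable `[1, +oo[ (EFin \o sqr_majorant s) by exact: (integrableS measurableT).
have mL : measurable_fun (`[(1 : R), +oo[%classic : set R) (log_majorant s).
  by apply: measurable_funTS; apply: continuous_measurable_fun; apply: continuous_log_majorant; exact: ltW.
(* [integrable_log_majorant] excludes the parameter 1, which [s] may equal; comparison with
   [sqr_majorant s] covers every [s > 0]. *)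
have iL1 : mu.-integrable `[1, +oo[ (EFin \o log_majorant s).
  have H t : `[1, +oo[%classic t -> `|log_majorant s t| <= (s + 1) ^+ 2 / s * sqr_majorant s t.
    rewrite /= in_itv/= andbT => t1; have t0 : 0 < t by lra.
    rewrite ger0_norm; last by rewrite log_majorant_ge0// ltW.
    rewrite /log_majorant /sqr_majorant (ger0_norm (ltW t0)).
    have p : 0 < 1 + s * t by rewrite ltr_wpDl// mulr_gt0.
    rewrite ler_pdivrMr; last by rewrite mulr_gt0//; lra.
    have -> : (s + 1) ^+ 2 / s * (s / (1 + s * t) ^+ 2) * ((1 + t) * (1 + s * t)) =
      (s + 1) ^+ 2 * (1 + t) / (1 + s * t) by field; rewrite !gt_eqF.
    by rewrite ler_pdivlMr//; nra.
  have c0 : 0 <= (s + 1) ^+ 2 / s by rewrite divr_ge0 ?sqr_ge0// ltW.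
  by have [] := majorized_Rintegral mi mL iQ (fun t => sqr_majorant_ge0 _ (ltW s0)) c0 H.
have Zl (F : R -> R) c : mu.-integrable `[1, +oo[ (EFin \o F) ->
    mu.-integrable `[1, +oo[ (EFin \o (fun t => c * F t)).
  move=> iF; rewrite (_ : EFin \o _ = (fun t => c%:E * (EFin \o F) t)%E); first exact: integrableZl.
  by apply/funext => t; rewrite /= EFinM.
have il := Zl _ (s / 2) iL1.
have iq := Zl _ (5 * s ^+ 2) iQ1.
have iB : mu.-integrable `[1, +oo[ (EFin \o (fun t => s / 2 * log_majorant s t - 5 * s ^+ 2 * sqr_majorant s t)).
  rewrite (_ : EFin \o _ = ((EFin \o (fun t => (s / 2 * log_majorant s t)%R)) \-
     (EFin \o (fun t => (5 * s ^+ 2 * sqr_majorant s t)%R)))%E).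
    exact: integrableB.
  by apply/funext => t; rewrite /= EFinB.
have main : s / 2 * \int[mu]_(t in `[1, +oo[) log_majorant s t - 10 * s ^+ 2 <= s * sine_transform s.
  have Q2 : \int[mu]_(t in `[1, +oo[) sqr_majorant s t <= 2.
    have H t : `[1, +oo[%classic t -> `|sqr_majorant s t| <= 1 * sqr_majorant s t.
      by move=> _; rewrite mul1r ger0_norm// sqr_majorant_ge0// ltW.
    have mQ : measurable_fun (`[(1 : R), +oo[%classic : set R) (sqr_majorant s).
      by apply: measurable_funTS; apply: continuous_measurable_fun; apply: continuous_sqr_majorant; exact: ltW.
    have [_] := majorized_Rintegral mi mQ iQ (fun t => sqr_majorant_ge0 _ (ltW s0)) ler01 H.
    by rewrite intQ mul1r => /(le_trans (ler_norm _)).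
  have -> : s * sine_transform s = \int[mu]_(t in `[1, +oo[) (s * (sin (s * t) / t ^+ 2)).
    by rewrite RintegralZl.
  apply: (@le_trans _ _ (\int[mu]_(t in `[1, +oo[) (s / 2 * log_majorant s t - 5 * s ^+ 2 * sqr_majorant s t))).
    rewrite RintegralB// RintegralZl// RintegralZl//.
    rewrite lerD2l lerN2.
    apply: (le_trans (ler_wpM2l (mulr_ge0 (ler0n _ 5) (sqr_ge0 s)) Q2)).
    by rewrite mulrAC -natrM.
  apply: le_Rintegral => //; first exact: Zl.
  by move=> t; rewrite /= in_itv/= andbT => t1; exact: sine_kernel_ge.
have L0 : 0 <= \int[mu]_(t in `[1, +oo[) log_majorant s t.
  by apply: Rintegral_ge0 => t _; rewrite log_majorant_ge0// ltW.
split.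
  apply: le_trans main; rewrite -[leLHS]add0r lerD2r.
  by apply: mulr_ge0 => //; apply: divr_ge0 => //; exact: ltW.
move=> s1; apply: le_trans main.
have sn1 : s != 1 by rewrite lt_eqF.
have -> : \int[mu]_(t in `[1, +oo[) log_majorant s t = s / (s - 1) * (ln s - ln ((1 + s) / 2)).
  by rewrite /Rintegral integral_log_majorant_itvcy//= mulr1.
have -> : s / 2 * (s / (s - 1) * (ln s - ln ((1 + s) / 2))) =
  s ^+ 2 * ((ln ((1 + s) / 2) - ln s) / 2 / (1 - s)).
  by field; apply/andP; split; apply/eqP; lra.
have l1 : - 1 <= ln ((1 + s) / 2).
  rewrite -[leLHS]expRK ler_ln ?posrE ?expR_gt0//; last by lra.
  by rewrite expRN; have := expR1_inv_le_half R; lra.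
have l2 : ln s <= ln ((1 + s) / 2) by rewrite ler_ln ?posrE//; lra.
have l3 : (ln ((1 + s) / 2) - ln s) / 2 <= (ln ((1 + s) / 2) - ln s) / 2 / (1 - s).
  by clear -l2 s1 s0; rewrite ler_pdivlMr; nra.
rewrite -mulrA [X in _ <= _ - X]mulrC -mulrBr; apply: ler_wpM2l; first exact: sqr_ge0.
clear -l1 l3; lra.
Qed.

Lemma sine_transformN s : sine_transform (- s) = - sine_transform s.
Proof.
rewrite /sine_transform -[RHS]mulN1r -RintegralZl; last 2 first.
- exact: measurable_itv.
- exact: sine_transform_integrable.
by apply: eq_Rintegral => t _; rewrite mulNr sinN; ring.
Qed.

Lemma mul_sine_transform_ge s : - (10 * s ^+ 2) <= s * sine_transform s.
Proof.
have [s0|s0|->] := ltgtP s 0; last by rewrite expr0n mul0r mulr0 oppr0.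
- have ns : 0 < - s by lra.
  by have [] := sine_transform_ge ns; rewrite sine_transformN sqrrN mulrNN.
- by have [] := sine_transform_ge s0.
Qed.

End Step.

(** * No second primitive of the transform of the step is Lipschitz *)

Section NotLipschitz.
Context {R : realType}.
Notation mu := (@lebesgue_measure R).
Implicit Types (l x y : R).

Lemma lipschitz_continuous (u : R -> R) L :
  (forall x y, `|u x - u y| <= L * `|x - y|) -> continuous u.
Proof.
move=> uL x; apply/cvgrPdist_lt => e e0.
have L1 : 0 < `|L| + 1 by rewrite ltr_wpDl.
near=> z; apply: (le_lt_trans (uL x z)).
have : `|x - z| < e / (`|L| + 1).
  by near: z; apply: cvgr_dist_lt; rewrite ?divr_gt0//; exact: cvg_id.
rewrite ltr_pdivlMr// => /(le_lt_trans _); apply.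
by rewrite mulrC ler_wpM2l// (le_trans (ler_norm L))// lerDl.
Unshelve. all: by end_near. Qed.

Definition sine_part x := complex.Im (Psi (@step R) x).

Lemma sine_partE x : sine_part x = - sine_transform x.
Proof. exact: Im_Psi_step. Qed.

Lemma sine_part_measurable_le :
  measurable_fun setT sine_part /\ forall x, `|sine_part x| <= 16.
Proof.
pose a t := complex.Im (@step R t); pose b t := - complex.Re (@step R t).
have E : sine_part = high_part a b by apply/funext => x; rewrite /sine_part PsiE.
have [[mR mI] _] := @Linfty_step R.
have mb : measurable_fun setT b by exact: (measurableT_comp _ mR).
have aM t : `|a t| <= 1 by rewrite /a Im_step normr0.
have bM t : `|b t| <= 1.
  by rewrite /b Re_step normrN; case: ifP; rewrite ?normr1 ?normr0.
rewrite E; split.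
  by apply: continuous_measurable_fun; exact: (continuous_high_part mI mb aM bM).
by move=> x; have [_] := high_part_integrable_le mI mb aM bM x; rewrite mulr1.
Qed.

Lemma sine_part_curvature_integrable l : 1 <= l ->
  mu.-integrable setT (EFin \o (fun x => sine_part x * curvature l x)).
Proof.
move=> l1; have [m b] := sine_part_measurable_le.
apply: (integrable_mul_curvature l1 m (ler0n _ 16)) => x.
by rewrite (le_trans (b x))// ler_peMr// lerDl.
Qed.

Lemma sine_part_mul_curvature l x : x != 0 -> sine_part x * curvature l x =
  (x * sine_transform x) * - (x * curvature l x) / x ^+ 2.
Proof. by move=> x0; rewrite sine_partE; field. Qed.

(** [270 = 10 * 27]: the floor [- 10 x^2] for [x * sine_transform x] is multiplied by the
    nonnegative [- (x * curvature l x)], itself at most [27 * sqr_majorant l x]. *)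
Lemma sine_part_curvature_ge l x : 1 <= l ->
  - (270 * sqr_majorant l x) <= sine_part x * curvature l x.
Proof.
move=> l1; have l0 : 0 <= l by lra.
have [->|x0] := eqVneq x 0.
  have T0 : sine_part 0 = 0.
    by have := @sine_transformN R 0; rewrite sine_partE oppr0 => h; lra.
  have g0 := sqr_majorant_ge0 0 l0.
  rewrite T0 [leRHS]mul0r.
  clear -g0; lra.
rewrite sine_part_mul_curvature//.
have x2 : 0 < x ^+ 2 by rewrite exprn_even_gt0.
rewrite ler_pdivlMr//.
have h1 := mul_sine_transform_ge x.
have h2 := mul_curvature_le0 x l0.
have b0 : 0 <= - (x * curvature l x) by rewrite oppr_ge0.
have h3 := norm_mul_curvature_le x l1.
rewrite ler0_norm// in h3.
have h4 := ler_wpM2r b0 h1.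
have h5 := ler_wpM2l (ltW x2) h3.
apply: (le_trans _ h4); clear -h5; lra.
Qed.

(** On this window [l x] lies in [[1/2, 1]], so the curvature is concentrated there and
    [- ln x >= ln l]. The threshold 22 makes [ln l / 2 - 11] nonnegative, as multiplying the two
    lower bounds requires. *)
Lemma sine_part_curvature_large : exists2 d, 0 < d & forall l x, 1 < l ->
  22 <= ln l -> (2 * l)^-1 <= x <= l^-1 ->
  (ln l / 2 - 11) * (l * d) <= sine_part x * curvature l x.
Proof.
have [d d0 Hd] := @curvature_concentration R; exists d => // l x l1 ll /andP[x1 x2].
have l0 : 0 < l by lra.
have x0 : 0 < x by rewrite (lt_le_trans _ x1)// invr_gt0 mulr_gt0.
have xn0 : x != 0 by rewrite gt_eqF.
have lx : 2^-1 <= l * x <= 1.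
  move: x1 x2; rewrite invfM ler_pdivrMr// mulrC => ->.
  by rewrite -(ler_pM2l l0) mulfV ?gt_eqF.
have x_lt1 : x < 1 by rewrite (le_lt_trans x2)// invf_lt1.
have lnx : ln l <= - ln x.
  by rewrite lerNr -lnV ?posrE// ler_ln ?posrE// invr_gt0.
have [_ /(_ x_lt1) h1] := sine_transform_ge x0.
have h2 := Hd l x l0 lx.
rewrite sine_part_mul_curvature// ler_pdivlMr ?exprn_gt0//.
have m0 : 0 <= ln l / 2 - 11 by lra.
have h3 : x ^+ 2 * (ln l / 2 - 11) <= x * sine_transform x.
  by apply: le_trans h1; apply: ler_wpM2l; [exact: sqr_ge0|lra].
have h4 := ler_pM (mulr_ge0 (sqr_ge0 x) m0) (mulr_ge0 (ltW l0) (ltW d0)) h3 h2.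
by rewrite [leLHS]mulrC [leLHS]mulrA.
Qed.

Lemma Rintegral_sine_part_curvature_ge : exists2 d, 0 < d & forall l, 1 < l ->
  22 <= ln l ->
  (ln l / 2 - 11) * d / 2 - 540 <= \int[mu]_x (sine_part x * curvature l x).
Proof.
have [d d0 Hd] := sine_part_curvature_large; exists d => // l l1 ll.
have l0 : 0 < l by lra.
have l1' := ltW l1.
have [iL intL] := integrable_sqr_majorant l0.
have iT := sine_part_curvature_integrable l1'.
have [ih eh] := integrable_linear 270 iT iL.
rewrite lerBlDr.
have -> : \int[mu]_x (sine_part x * curvature l x) + 540 =
    \int[mu]_x (sine_part x * curvature l x + 270 * sqr_majorant l x).
  by rewrite eh intL -natrM.
pose A := `[(2 * l)^-1, l^-1]%classic : set R.
pose c := (ln l / 2 - 11) * (l * d).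
have mA : measurable A by exact: measurable_itv.
have c0 : 0 <= c by apply: mulr_ge0; [lra|apply: mulr_ge0; exact: ltW].
have iA : mu.-integrable A (EFin \o cst c).
  apply: continuous_compact_integrable; first exact: segment_compact.
  by apply: continuous_subspaceT => z; exact: cvg_cst.
have -> : (ln l / 2 - 11) * d / 2 = \int[mu]_(x in A) c.
  rewrite Rintegral_cst// [X in fine X](_ : _ = ((2 * l)^-1)%:E).
    by rewrite /c /=; field; rewrite gt_eqF.
  transitivity (mu A) => //.
  rewrite /A lebesgue_measure_itv/= lte_fin ifT.
    by rewrite -EFinD; congr EFin; field; rewrite gt_eqF.
  by rewrite ltf_pV2 ?posrE ?mulr_gt0//; lra.
rewrite Rintegral_mkcond; apply: le_Rintegral => //.
- by have := (@integrable_mkcond _ _ _ mu A (EFin \o cst c) mA).1 iA; rewrite restrict_EFin.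
- move=> x _; rewrite patchE; case: ifP => [xA|_].
    apply: (@le_trans _ _ (sine_part x * curvature l x)).
      by apply: Hd => //; move: xA; rewrite inE /A/= in_itv.
    by rewrite lerDl; apply: mulr_ge0; [exact: ler0n|apply: sqr_majorant_ge0; exact: ltW].
  by rewrite -lerBlDr sub0r; exact: sine_part_curvature_ge.
Qed.

Lemma cderiven_logistic_step l x :
  cderiven 2 (fun x => (logistic_step l x)%:C) x =
  (curvature l x - curvature 1 x) +i* 0.
Proof.
have z : derive1n 2 (fun=> 0 : R) x = 0 by rewrite derive1n_cst0.
have e : derive1n 2 (logistic_step l) x = curvature l x - curvature 1 x.
  by rewrite derive1n_logistic_step.
exact: (congr2 (fun x y => x +i* y) e z).
Qed.

Lemma Im_mul_real (z : R[i]) x : complex.Im (z * (x +i* 0)) = complex.Im z * x.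
Proof. by rewrite ImM /= mulr0 add0r. Qed.

Lemma RintegralMBr (u a b : R -> R) :
  mu.-integrable setT (EFin \o (fun x => u x * a x)) ->
  mu.-integrable setT (EFin \o (fun x => u x * b x)) ->
  \int[mu]_x (u x * (a x - b x)) =
  \int[mu]_x (u x * a x) - \int[mu]_x (u x * b x).
Proof.
move=> i1 i2; rewrite -RintegralB//.
by apply: eq_Rintegral => x _; rewrite mulrBr.
Qed.

(** Testing the distributional identity directly handles every [Phi] at once, without showing that
    two second primitives differ by an affine function. The test functions are real, so imaginary
    parts can be compared alone. *)
Lemma second_primitive_step_not_lipschitz (Phi : R -> R[i]) :
  is_second_distr_derivative Phi (fourier (@step R)) -> ~ clipschitz Phi.
Proof.
move=> dPhi [L PhiL].
have L0 : 0 <= L.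
  have := PhiL 1 0; rewrite subr0 normr1 mulr1; apply: le_trans.
  exact: le_trans (normr_ge0 _) (normc_ge_Re _).
pose u x := complex.Im (Phi x).
have uL x y : `|u x - u y| <= L * `|x - y|.
  by rewrite /u -ImB (le_trans (normc_ge_Im _)).
have mu_ : measurable_fun setT u.
  by apply: continuous_measurable_fun; exact: lipschitz_continuous uL.
have iu l : 1 <= l -> mu.-integrable setT (EFin \o (fun x => u x * curvature l x)).
  move=> l1; apply: (@integrable_mul_curvature _ l u (`|u 0| + L)) => //.
    by rewrite addr_ge0.
  move=> x; have := uL x 0; rewrite subr0 => h.
  have -> : u x = (u x - u 0) + u 0 by ring.
  apply: (le_trans (ler_normD _ _)); have := normr_ge0 x; have := normr_ge0 (u 0).
  clear -h L0; nra.
have [I IE] : exists I : R -> R, forall l,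
    I l = \int[mu]_x (sine_part x * curvature l x) by eexists.
have [J JE] : exists J : R -> R, forall l,
    J l = \int[mu]_x (u x * curvature l x) by eexists.
have rel l : 1 <= l -> - (I l - I 1) = J l - J 1.
  rewrite !IE !JE.
  move=> l1; have [_ E] := dPhi _ (schwartz_logistic_step l1).
  have e1 := RintegralMBr (iu l l1) (iu 1 (lexx 1)).
  have e2 := RintegralMBr (sine_part_curvature_integrable l1)
    (sine_part_curvature_integrable (lexx 1)).
  apply: etrans (congr1 -%R (esym e2)) (etrans _ e1).
  have EA x : complex.Im (Phi x * cderiven 2 (fun x => (logistic_step l x)%:C) x) =
      u x * (curvature l x - curvature 1 x).
    by rewrite cderiven_logistic_step Im_mul_real.
  have EB x : complex.Im (Psi (@step R) x * cderiven 2 (fun x => (logistic_step l x)%:C) x) =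
      sine_part x * (curvature l x - curvature 1 x).
    by rewrite cderiven_logistic_step Im_mul_real.
  have EC x : complex.Im (fhat1 (@step R) x * (logistic_step l x)%:C) = 0.
    by rewrite fhat1_step mul0r.
  have := congr1 (@complex.Im R) E; rewrite /fourier ImB.
  rewrite [complex.Im (cintegral _ _)](_ : _ = \int[mu]_x (0 : R)); last first.
    by apply: eq_Rintegral => x _; exact: EC.
  rewrite Rintegral_cst// mul0r sub0r => H.
  apply: etrans (etrans _ H) _.
    by apply: congr1; apply: eq_Rintegral => x _; exact: esym (EB x).
  by apply: eq_Rintegral => x _; exact: EA.
have [d d0 IB] : exists2 d, 0 < d & forall l, 1 < l -> 22 <= ln l ->
    (ln l / 2 - 11) * d / 2 - 540 <= I l.
  have [d d0 Hd] := Rintegral_sine_part_curvature_ge.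
  by exists d => // l l1 ll; rewrite IE; exact: Hd.
have JB l : 1 <= l -> `|J l| <= 54 * L.
  by move=> l1; rewrite JE; exact: lipschitz_curvature_le.
(* Solves [(y / 2 - 11) * d / 2 = 541 + |I 1| + 108 L]: after subtracting 540, [I (expR y)] exceeds
   by 1 the bound [|I 1| + 2 * 54 * L] that [rel] and [JB] impose. *)
pose y := 22 + 4 / d * (541 + `|I 1| + 108 * L).
have y22 : 22 <= y.
  rewrite lerDl; apply: mulr_ge0; first by apply: divr_ge0 => //; exact: ltW.
  by have n1 := normr_ge0 (I 1); clear -n1 L0; lra.
have l1 : 1 < expR y by rewrite -expR0 ltr_expR; lra.
have := IB (expR y) l1; rewrite expRK => /(_ y22) IBy.
have rely := rel _ (ltW l1).
have /ler_normlP[Jy1 Jy2] := JB _ (ltW l1).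
have /ler_normlP[J11 J12] := JB _ (lexx 1).
have nI := ler_norm (I 1).
have E : (y / 2 - 11) * d / 2 = 541 + `|I 1| + 108 * L.
  by rewrite /y; field; rewrite gt_eqF.
rewrite E in IBy.
by clear -IBy rely Jy1 Jy2 J11 J12 nI; lra.
Qed.

End NotLipschitz.

Theorem theorem2p4 (R : realType) :
  (exists k : R, forall f : R -> R[i], Linfty f ->
     exists Phi : R -> R[i],
       [/\ continuous (Phi : R -> R[i]^o),
           is_second_distr_derivative Phi (fourier f)
         & forall s h : R, 0 < `|h| <= (expR 1)^-1 ->
             Normc.normc (Phi (s + h) - Phi s)
               <= k * Linfty_norm f * `|h| * (`|ln `|h| | + ln (`|s| + 1))])
  /\
  (exists f : R -> R[i],
     Linfty f
     /\ forall Phi : R -> R[i],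
          continuous (Phi : R -> R[i]^o) ->
          is_second_distr_derivative Phi (fourier f) ->
          ~ clipschitz Phi).

Proof.
split; first by exists 400 => f; exact: second_primitive_exists.
exists (@step R); split; first exact: Linfty_step.
by move=> Phi _; exact: second_primitive_step_not_lipschitz.
Qed.
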